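(* Let $x=(a,s,p):\mathbb{D}\to\overline{\mathcal{P}}$ be a rational $\overline{\mathcal{P}}$-inner function of degree $(m,n)$. Let $a\neq0$ and let an inner-outer factorization of $a$ be given by $a=a_{in}a_{out}$, where $a_{in}$ is an inner function and $a_{out}$ is an outer function. Then there exist polynomials $A,E,D$ such that 1. $\deg(A),\deg(E),\deg(D)\le n$; 2. $E^{\sim n}=E$; 3. $D(\lambda)\neq0$ on $\overline{\mathbb{D}}$; 4. $|E(\lambda)|\le2|D(\lambda)|$ on $\overline{\mathbb{D}}$; 5. $A$ is an outer polynomial such that $|A(\lambda)|^2=|D(\lambda)|^2-\frac14|E(\lambda)|^2$ on $\mathbb{T}$; 6. $a=a_{in}\dfrac{A}{D}$ on $\overline{\mathbb{D}}$; 7. $s=\dfrac{E}{D}$ on $\overline{\mathbb{D}}$; 8. $p=\dfrac{D^{\sim n}}{D}$ on $\overline{\mathbb{D}}$.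
   Context: $\mathbb{D}$ is the open unit disc in $\mathbb{C}$, $\mathbb{T}$ the unit circle. $\mathbb{B}^{2\times2}$ is the open unit ball of the space of complex $2\times2$ matrices in the operator norm. The pentablock is $\mathcal{P}=\{(a_{21},\operatorname{tr}A,\det A): A=[a_{ij}]_{i,j=1}^2\in\mathbb{B}^{2\times2}\}\subset\mathbb{C}^3$, with closure $\overline{\mathcal{P}}$. The distinguished boundary of $\mathcal{P}$ is $$b\overline{\mathcal{P}}=\Big\{(a,s,p)\in\mathbb{C}^3: |s|\le2,\ |p|=1,\ s=\overline{s}p,\ |a|=\sqrt{1-\tfrac14|s|^2}\Big\}.$$ A rational $\overline{\mathcal{P}}$-inner (or penta-inner) function is a rational analytic map $x:\mathbb{D}\to\overline{\mathcal{P}}$ (which extends continuously to $\overline{\mathbb{D}}$) that maps $\mathbb{T}$ into $b\overline{\mathcal{P}}$. Its degree is the pair $(\deg a,\deg p)$ of degrees of the rational functions $a$ and $p$. For a polynomial $g$ of degree at most $n$, $g^{\sim n}(\lambda)=\lambda^n\overline{g(1/\overline{\lambda})}$. A polynomial is outer if it has no zeros in $\mathbb{D}$. *)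

(* Defs.v *)
From HB Require Import structures.
From mathcomp Require Import all_boot all_order all_algebra.
From mathcomp Require Import complex.
From mathcomp Require Import all_classical all_reals all_analysis.

Set Implicit Arguments.
Unset Strict Implicit.
Unset Printing Implicit Defensive.

Import Order.TTheory GRing.Theory Num.Theory.
Import numFieldNormedType.Exports.

Local Open Scope classical_set_scope.
Local Open Scope ring_scope.

(* R[i] itself carries no topology; packed as a numClosedFieldType it gets the
   norm topology that MathComp-Analysis puts on every numFieldType. *)
Definition Cplx (R : realType) : numClosedFieldType := R[i]%C.

Definition disc (R : realType) : set (Cplx R) := [set z | `|z| < 1].
Definition cdisc (R : realType) : set (Cplx R) := [set z | `|z| <= 1].
Definition circle (R : realType) : set (Cplx R) := [set z | `|z| = 1].

Definition ofR (R : realType) (x : R) : Cplx R := Complex x 0.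
Definition cexp (R : realType) (z : Cplx R) : Cplx R :=
  Complex (expR (complex.Re z) * cos (complex.Im z))
          (expR (complex.Re z) * sin (complex.Im z)).
Definition cis (R : realType) (t : R) : Cplx R := Complex (cos t) (sin t).

(** Pentablock *)

Definition l2norm (R : realType) (n : nat) (v : 'cV[Cplx R]_n) : R :=
  Num.sqrt (\sum_(i < n) complex.Re `|v i 0| ^+ 2).

Definition opnorm (R : realType) (n : nat) (A : 'M[Cplx R]_n) : R :=
  sup [set l2norm (A *m v) | v in [set v : 'cV[Cplx R]_n | l2norm v <= 1]].

(* Matrix indices start at 0, so a_21 is [A 1 0]. *)
Definition pentablock (R : realType) : set (Cplx R * Cplx R * Cplx R) :=
  [set (A 1 0, \tr A, \det A) | A in [set A : 'M[Cplx R]_2 | opnorm A < 1]].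

Definition bpentablock (R : realType) : set (Cplx R * Cplx R * Cplx R) :=
  [set x | let: (a, s, p) := x in
    [/\ `|s| <= 2, `|p| = 1, s = s^* * p
      & `|a| = sqrtC (1 - `|s| ^+ 2 / 4)] ].

(** Rational functions on the disc *)

(* On the open disc f is N / Q, in lowest terms and without poles there;
   N and Q are then unique up to a common nonzero constant factor. *)
Definition ratrep (R : realType) (f : Cplx R -> Cplx R) (N Q : {poly Cplx R}) :=
  coprimep N Q /\
  forall z, disc z -> Q.[z] != 0 /\ f z = N.[z] / Q.[z].

Definition rational (R : realType) (f : Cplx R -> Cplx R) :=
  exists N Q, ratrep f N Q.

Definition has_rdeg (R : realType) (f : Cplx R -> Cplx R) (d : nat) :=
  exists N Q, ratrep f N Q /\ d = maxn (size N).-1 (size Q).-1.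

(* The functions are total; only their values on the closed disc matter, those
   on the circle being fixed by continuity. *)
Definition penta_inner (R : realType) (a s p : Cplx R -> Cplx R) :=
  [/\ [/\ rational a, rational s & rational p],
      [/\ {within @cdisc R, continuous a}, {within @cdisc R, continuous s}
        & {within @cdisc R, continuous p}],
      forall z, disc z -> closure (@pentablock R) (a z, s z, p z)
    & forall z, circle z -> bpentablock (a z, s z, p z)].

Definition penta_degree (R : realType) (a s p : Cplx R -> Cplx R) (m n : nat) :=
  has_rdeg a m /\ has_rdeg p n.

(** Inner and outer functions *)

Definition inner_fun (R : realType) (f : Cplx R -> Cplx R) :=
  [/\ forall z : Cplx R, disc z -> derivable f z 1,
      forall z, disc z -> `|f z| <= 1
    & {ae @lebesgue_measure R, forall t : R, `[0, 2 * pi]%classic t ->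
         exists2 l : Cplx R, `|l| = 1 &
           f (ofR r * cis t) @[r --> (1 : R)^'-] --> l}].

Definition Cintegral (R : realType) (D : set R) (g : R -> Cplx R) : Cplx R :=
  Complex (\int[@lebesgue_measure R]_(t in D) complex.Re (g t))
          (\int[@lebesgue_measure R]_(t in D) complex.Im (g t)).

(* Outer functions in the sense of Beurling:
   f(z) = c exp((2 pi)^-1 int_0^{2 pi} (e^{it}+z)/(e^{it}-z) log(phi(t)) dt). *)
Definition outer_fun (R : realType) (f : Cplx R -> Cplx R) :=
  exists (phi : R -> R) (c : Cplx R),
  [/\ measurable_fun `[0, 2 * pi] phi,
      forall t, `[0, 2 * pi]%classic t -> 0 < phi t,
      (@lebesgue_measure R).-integrable `[0, 2 * pi] (fun t => (ln (phi t))%:E),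
      `|c| = 1
    & forall z, disc z ->
        f z = c * cexp (ofR (2 * pi)^-1 *
          Cintegral `[0, 2 * pi]
            (fun t => (cis t + z) / (cis t - z) * ofR (ln (phi t))))].

Definition outer_poly (R : realType) (A : {poly Cplx R}) :=
  forall z, disc z -> A.[z] != 0.

Definition cdisc_extension (R : realType) (f g : Cplx R -> Cplx R) :=
  {within @cdisc R, continuous g} /\ forall z, disc z -> g z = f z.

(* g^{~n}(z) = z^n conj(g(1 / conj z)), see [horner_revp]. *)
Definition revp (R : realType) (n : nat) (g : {poly Cplx R}) : {poly Cplx R} :=
  \poly_(i < n.+1) (g`_(n - i))^*.

Lemma horner_revp (R : realType) (n : nat) (g : {poly Cplx R}) (z : Cplx R) :
  (size g <= n.+1)%N -> z != 0 ->
  (revp n g).[z] = z ^+ n * (g.[(z^*)^-1])^*.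
Proof.
move=> gn z0; rewrite /revp horner_poly (horner_coef_wide _ gn).
rewrite rmorph_sum mulr_sumr (reindex_inj rev_ord_inj) /=.
apply: eq_bigr => i _; have lein : (i <= n)%N by rewrite -ltnS.
rewrite subSS subKn // rmorphM rmorphXn fmorphV /= conjCK mulrCA; congr (_ * _).
by rewrite expfB_cond ?exprVn //; rewrite (negPf z0).
Qed.

(* Main.v *)
Require Import Defs.
From HB Require Import structures.
From mathcomp Require Import all_boot all_order all_algebra.
From mathcomp Require Import complex.
From mathcomp Require Import all_classical all_reals all_analysis measurable_realfun.
From mathcomp Require Import ring lra zify.

Import Order.TTheory GRing.Theory Num.Theory.
Import numFieldNormedType.Exports.

Local Open Scope classical_set_scope.
Local Open Scope ring_scope.

Set Implicit Arguments.
Unset Strict Implicit.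
Unset Printing Implicit Defensive.

(** On the circle p has modulus 1, so in lowest terms p = N / Q with N proportional to the
reflection of Q; normalizing the constant gives p = (rev D) / D with D zero free on the closed
disc. The symmetry s = conj s p then says that the poles of s are among the zeros of D, and that
E = s D is its own reflection. The bound |s| <= 2 holds on the pentablock because |tr A| is at
most twice the norm of A, and passes to the closure.

For the first component write a = B (A1 / Q), with B a finite Blaschke product and A1 the
numerator of a with its roots reflected out of the disc. The relation |a|^2 = 1 - |s|^2 / 4 on
the circle is a polynomial identity which shows that Q divides A1 D and that the quotient
A = A1 D / Q has degree at most n; thus A is a spectral factor of |D|^2 - |E|^2 / 4, and
a = B A / D.
These are [inner_denominator], [symmetric_numerator] and [outer_numerator].

It remains to see that the given inner factor a_in is B up to a unimodular constant, that is, that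
the Beurling outer function a_out is a constant multiple of A1 / Q ([inner_outer_unique]). The
function V = a_out Q is the exponential of a Herglotz integral, up to a constant. From
|a_in| <= 1 one gets |V| >= |A1 B|, hence |V| >= |A1| by Poisson integration on circles of radius
r < 1, on which the roots of B can be reflected as well. From the unimodular radial limits of
a_in one gets that |V| has radial limits |A1| almost everywhere; since ln |V| is the Poisson
integral of an integrable function, and not just of a measure, this implies |V| <= |A1|
([smirnov_max_principle]). Two functions that are exponentials of Herglotz integrals and have the
same modulus differ by a constant.

The analysis behind this is elementary: Herglotz integrals are uniform limits of polynomials on
smaller discs ([herglotz_uniform]), polynomials satisfy the Schwarz formula ([schwarz_poly]), and
a polynomial zero free on the closed disc is outer, by its factorization and the logarithm series
([outer_rep_poly]). *)

(** * Complex numbers through real and imaginary parts *)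

Section ComplexBasics.
Variable R : realType.
Implicit Types (x y : R) (z w : Cplx R).

(** The norm of the field is complex-valued and only partially ordered; its real part is
the modulus as a real number, to which real arithmetic and measure theory apply. *)
Definition cnorm z : R := complex.Re `|z|.

Lemma ReD z w : complex.Re (z + w) = complex.Re z + complex.Re w.
Proof. by case: z w => [? ?] [? ?]. Qed.
Lemma ImD z w : complex.Im (z + w) = complex.Im z + complex.Im w.
Proof. by case: z w => [? ?] [? ?]. Qed.
Lemma ReN z : complex.Re (- z) = - complex.Re z.
Proof. by case: z => [? ?]. Qed.
Lemma ImN z : complex.Im (- z) = - complex.Im z.
Proof. by case: z => [? ?]. Qed.
Lemma ReM z w :
  complex.Re (z * w) = complex.Re z * complex.Re w - complex.Im z * complex.Im w.
Proof. by case: z w => [? ?] [? ?]. Qed.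
Lemma ImM z w :
  complex.Im (z * w) = complex.Re z * complex.Im w + complex.Im z * complex.Re w.
Proof. by case: z w => [? ?] [? ?]. Qed.

Definition ReImE := (ReD, ImD, ReN, ImN, ReM, ImM).

Lemma complexP z w :
  complex.Re z = complex.Re w -> complex.Im z = complex.Im w -> z = w.
Proof. by case: z w => [? ?] [? ?] /= -> ->. Qed.

Lemma ofRD x y : ofR (x + y) = ofR x + ofR y. Proof. exact: (rmorphD (real_complex R)). Qed.
Lemma ofRB x y : ofR (x - y) = ofR x - ofR y. Proof. exact: (rmorphB (real_complex R)). Qed.
Lemma ofRM x y : ofR (x * y) = ofR x * ofR y. Proof. exact: (rmorphM (real_complex R)). Qed.
Lemma ofRV x : ofR x^-1 = (ofR x)^-1. Proof. exact: (fmorphV (real_complex R)). Qed.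
Lemma ofRX x n : ofR (x ^+ n) = ofR x ^+ n. Proof. exact: (rmorphXn (real_complex R)). Qed.
Lemma ofR0 : ofR 0 = 0 :> Cplx R. Proof. by []. Qed.
Lemma ofR1 : ofR 1 = 1 :> Cplx R. Proof. by []. Qed.
Lemma ofR_nat n : ofR n%:R = n%:R :> Cplx R. Proof. exact: (rmorph_nat (real_complex R)). Qed.
Lemma ofR_inj : injective (@ofR R). Proof. by move=> x y []. Qed.
Lemma ofR_eq0 x : (ofR x == 0) = (x == 0).
Proof. exact: (fmorph_eq0 (real_complex R)). Qed.

Lemma ler_ofR x y : (ofR x <= ofR y) = (x <= y). Proof. exact: lecR. Qed.
Lemma ltr_ofR x y : (ofR x < ofR y) = (x < y). Proof. exact: ltcR. Qed.

Lemma ReZ x z : complex.Re (ofR x * z) = x * complex.Re z.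
Proof. by rewrite ReM /= mul0r subr0. Qed.
Lemma ImZ x z : complex.Im (ofR x * z) = x * complex.Im z.
Proof. by rewrite ImM /= mul0r addr0. Qed.

Lemma cnormE z : `|z| = ofR (cnorm z).
Proof. by rewrite /cnorm !(@normc_def R z). Qed.
Lemma cnorm_sqrt z :
  cnorm z = Num.sqrt (complex.Re z ^+ 2 + complex.Im z ^+ 2).
Proof. by rewrite /cnorm (@normc_def R z). Qed.
Lemma cnorm_ge0 z : 0 <= cnorm z.
Proof. by rewrite cnorm_sqrt sqrtr_ge0. Qed.
Lemma cnorm_sqr z : cnorm z ^+ 2 = complex.Re z ^+ 2 + complex.Im z ^+ 2.
Proof. by rewrite cnorm_sqrt sqr_sqrtr // addr_ge0 // sqr_ge0. Qed.
Lemma cnormM z w : cnorm (z * w) = cnorm z * cnorm w.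
Proof. by apply: ofR_inj; rewrite ofRM -!cnormE normrM. Qed.
Lemma cnormV z : cnorm z^-1 = (cnorm z)^-1.
Proof. by apply: ofR_inj; rewrite ofRV -!cnormE normfV. Qed.
Lemma cnormX z n : cnorm (z ^+ n) = cnorm z ^+ n.
Proof. by apply: ofR_inj; rewrite ofRX -!cnormE normrX. Qed.
Lemma cnormN z : cnorm (- z) = cnorm z.
Proof. by apply: ofR_inj; rewrite -!cnormE normrN. Qed.
Lemma cnormD z w : cnorm (z + w) <= cnorm z + cnorm w.
Proof. by rewrite -ler_ofR ofRD -!cnormE ler_normD. Qed.
Lemma cnormB z w : cnorm (z - w) <= cnorm z + cnorm w.
Proof. by rewrite -(cnormN w) cnormD. Qed.
Lemma cnorm_distC z w : cnorm (z - w) = cnorm (w - z).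
Proof. by rewrite -cnormN opprB. Qed.
Lemma cnorm_leB z w : cnorm z - cnorm w <= cnorm (z - w).
Proof. by rewrite lerBlDr -{1}(subrK w z) cnormD. Qed.
Lemma cnorm_eq0 z : (cnorm z == 0) = (z == 0).
Proof. by rewrite -ofR_eq0 -cnormE normr_eq0. Qed.
Lemma cnorm_gt0 z : (0 < cnorm z) = (z != 0).
Proof. by rewrite lt_def cnorm_ge0 cnorm_eq0 andbT. Qed.
Lemma cnorm0 : cnorm 0 = 0. Proof. by apply/eqP; rewrite cnorm_eq0. Qed.
Lemma cnorm1 : cnorm 1 = 1.
Proof. by apply: ofR_inj; rewrite -cnormE normr1. Qed.
Lemma cnorm_ofR x : cnorm (ofR x) = `|x|.
Proof. by rewrite cnorm_sqrt /= expr0n addr0 sqrtr_sqr. Qed.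
Lemma cnorm_conj z : cnorm z^* = cnorm z.
Proof. by apply: ofR_inj; rewrite -!cnormE norm_conjC. Qed.
Lemma Re_conj z : complex.Re z^* = complex.Re z.
Proof. by case: z. Qed.
Lemma Im_conj z : complex.Im z^* = - complex.Im z.
Proof. by case: z. Qed.

Lemma ler_Re z : `|complex.Re z| <= cnorm z.
Proof.
by rewrite cnorm_sqrt -sqrtr_sqr ler_sqrt ?lerDl ?sqr_ge0 // addr_ge0 ?sqr_ge0.
Qed.
Lemma ler_Im z : `|complex.Im z| <= cnorm z.
Proof.
by rewrite cnorm_sqrt -sqrtr_sqr ler_sqrt ?lerDr ?sqr_ge0 // addr_ge0 ?sqr_ge0.
Qed.
Lemma cnorm_ReIm z : cnorm z <= `|complex.Re z| + `|complex.Im z|.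
Proof.
rewrite -ler_sqr ?nnegrE ?cnorm_ge0 ?addr_ge0 // cnorm_sqr sqrrD !real_normK ?num_real //.
by rewrite addrAC lerDl mulrn_wge0 // mulr_ge0.
Qed.
Lemma Re_leN z : complex.Re z <= cnorm z.
Proof. exact: le_trans (ler_norm _) (ler_Re z). Qed.

Lemma discE z : disc z <-> cnorm z < 1.
Proof. by rewrite /disc /= cnormE -ofR1 ltr_ofR. Qed.
Lemma cdiscE z : cdisc z <-> cnorm z <= 1.
Proof. by rewrite /cdisc /= cnormE -ofR1 ler_ofR. Qed.
Lemma circleE z : circle z <-> cnorm z = 1.
Proof.
rewrite /circle /= cnormE -ofR1; split; [exact: ofR_inj|by move=> ->].
Qed.

Lemma cnorm_cis x : cnorm (cis x) = 1.
Proof. by rewrite cnorm_sqrt /= cos2Dsin2 sqrtr1. Qed.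
Lemma cis_neq0 x : cis x != 0.
Proof. by rewrite -cnorm_gt0 cnorm_cis. Qed.
Lemma cisD x y : cis (x + y) = cis x * cis y.
Proof.
apply: complexP; rewrite !ReImE /=; first exact: cosD.
by rewrite sinD addrC [X in X + _]mulrC [X in _ + X]mulrC addrC mulrC [X in _ + X]mulrC.
Qed.
Lemma cis0 : cis 0 = 1 :> Cplx R. Proof. by rewrite /cis cos0 sin0. Qed.
Lemma cisX x n : cis x ^+ n = cis (n%:R * x).
Proof.
elim: n => [|n IHn]; first by rewrite expr0 mul0r cis0.
by rewrite exprSr IHn -cisD -natr1 mulrDl mul1r.
Qed.
Lemma cisN x : cis (- x) = (cis x)^-1.
Proof.
by apply: (mulIf (cis_neq0 x)); rewrite -cisD addNr cis0 mulVf ?cis_neq0.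
Qed.
Lemma conj_cis x : (cis x)^* = (cis x)^-1.
Proof. by rewrite -cisN; apply: complexP; rewrite ?Re_conj ?Im_conj /= ?cosN ?sinN. Qed.

Lemma cexpE z : cexp z = ofR (expR (complex.Re z)) * cis (complex.Im z).
Proof. by apply: complexP; rewrite ?ReZ ?ImZ. Qed.
Lemma cexpD z w : cexp (z + w) = cexp z * cexp w.
Proof. by rewrite !cexpE !ReImE expRD cisD ofRM mulrACA. Qed.
Lemma cexp0 : cexp 0 = 1 :> Cplx R.
Proof. by rewrite cexpE /= expR0 cis0 mulr1. Qed.
Lemma cnorm_cexp z : cnorm (cexp z) = expR (complex.Re z).
Proof. by rewrite cexpE cnormM cnorm_cis cnorm_ofR mulr1 ger0_norm ?expR_ge0. Qed.
Lemma cexp_neq0 z : cexp z != 0.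
Proof. by rewrite -cnorm_gt0 cnorm_cexp expR_gt0. Qed.
Lemma cexp_ofR x : cexp (ofR x) = ofR (expR x).
Proof. by rewrite cexpE /= cis0 mulr1. Qed.

End ComplexBasics.

(** * Means over the circle *)

Section CircleMean.
Variable R : realType.
Notation mu := (@lebesgue_measure R).
Notation turn := (`[0, 2 * pi]%classic : set R).
Implicit Types (h : R -> R) (g : R -> Cplx R).

Definition rintegrable h := mu.-integrable turn (EFin \o h).
Definition avg h : R := (2 * pi)^-1 * \int[mu]_(t in turn) h t.

Lemma measurable_turn : measurable (turn : set (measurableTypeR R)).
Proof. exact: measurable_itv. Qed.
Hint Resolve measurable_turn : core.

Lemma twopi_gt0 : 0 < 2 * pi :> R.
Proof. by rewrite mulr_gt0 // pi_gt0. Qed.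

Lemma rint_cont h : continuous h -> rintegrable h.
Proof.
move=> ch; apply: continuous_compact_integrable; first exact: segment_compact.
exact: continuous_subspaceT.
Qed.

Lemma rint_cst c : rintegrable (fun=> c).
Proof. by apply: rint_cont => x; exact: cvg_cst. Qed.

Lemma rintD h1 h2 : rintegrable h1 -> rintegrable h2 -> rintegrable (fun t => h1 t + h2 t).
Proof. by move=> i1 i2; have := integrableD measurable_turn i1 i2. Qed.

Lemma rintZ c h : rintegrable h -> rintegrable (fun t => c * h t).
Proof. by move=> i1; have := integrableZl measurable_turn c i1. Qed.

Lemma rintN h : rintegrable h -> rintegrable (fun t => - h t).
Proof. by move=> i1; have := integrableN i1. Qed.

Lemma rintB h1 h2 : rintegrable h1 -> rintegrable h2 -> rintegrable (fun t => h1 t - h2 t).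
Proof. by move=> i1 i2; apply: rintD => //; exact: rintN. Qed.

Lemma rint_norm h : rintegrable h -> rintegrable (fun t => `|h t|).
Proof. by move=> i1; have := integrable_norm i1. Qed.

Lemma cont_bounded h : continuous h -> [bounded h x | x in turn].
Proof.
move=> ch; have ch' : {within turn, continuous h} by exact: continuous_subspaceT.
have := continuous_compact ch' (@segment_compact R 0 (2 * pi)).
move=> /compact_bounded[M [Mr mrt]]; exists M; split => // N MN t tI.
by apply: (mrt _ MN); exists t.
Qed.

Lemma cont_measurable h : continuous h -> measurable_fun turn h.
Proof.
move=> ch; apply: subspace_continuous_measurable_fun => //.
exact: continuous_subspaceT.
Qed.

Lemma rintM (f h : R -> R) : continuous f -> rintegrable h -> rintegrable (fun t => f t * h t).
Proof.
move=> cf ih; have := integrableMr measurable_turn (cont_measurable cf) (cont_bounded cf) ih.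
by [].
Qed.

Lemma avgD h1 h2 : rintegrable h1 -> rintegrable h2 ->
  avg (fun t => h1 t + h2 t) = avg h1 + avg h2.
Proof. by move=> i1 i2; rewrite /avg RintegralD // mulrDr. Qed.

Lemma avgB h1 h2 : rintegrable h1 -> rintegrable h2 ->
  avg (fun t => h1 t - h2 t) = avg h1 - avg h2.
Proof. by move=> i1 i2; rewrite /avg RintegralB // mulrBr. Qed.

Lemma avgZ c h : rintegrable h -> avg (fun t => c * h t) = c * avg h.
Proof. by move=> i; rewrite /avg RintegralZl // mulrCA. Qed.

Lemma avg_cst c : avg (fun=> c) = c.
Proof.
rewrite /avg Rintegral_cst //= lebesgue_measure_itv /= lte_fin twopi_gt0 /= subr0.
by rewrite mulrCA mulVf ?mulr1 // gt_eqF // twopi_gt0.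
Qed.

Lemma ler_avg h1 h2 : rintegrable h1 -> rintegrable h2 ->
  (forall t, h1 t <= h2 t) -> avg h1 <= avg h2.
Proof.
move=> i1 i2 h12; rewrite /avg ler_pM2l ?invr_gt0 ?twopi_gt0 //.
exact: le_Rintegral.
Qed.

Lemma eq_avg h1 h2 : h1 =1 h2 -> avg h1 = avg h2.
Proof. by move=> /funext ->. Qed.

Lemma avg_norm h1 h2 : rintegrable h1 -> rintegrable h2 ->
  (forall t, `|h1 t| <= h2 t) -> `|avg h1| <= avg h2.
Proof.
move=> i1 i2 h12; rewrite ler_norml; apply/andP; split.
  rewrite -[avg h1]opprK lerN2 -mulN1r -avgZ //; apply: ler_avg => //; first exact: rintZ.
  by move=> t; rewrite mulN1r (le_trans _ (h12 t)) // -normrN ler_norm.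
by apply: ler_avg => // t; rewrite (le_trans _ (h12 t)) // ler_norm.
Qed.

(** Continuity of the two real components: integrands on the circle are handled in this form,
so that only the topology of the reals is involved. *)
Definition ccont g := continuous (fun t => complex.Re (g t)) /\
  continuous (fun t => complex.Im (g t)).
Definition cintegrable g := rintegrable (fun t => complex.Re (g t)) /\
  rintegrable (fun t => complex.Im (g t)).
Definition mean g : Cplx R := ofR (2 * pi)^-1 * Cintegral turn g.

Lemma Re_mean g : complex.Re (mean g) = avg (fun t => complex.Re (g t)).
Proof. by rewrite /mean ReZ. Qed.
Lemma Im_mean g : complex.Im (mean g) = avg (fun t => complex.Im (g t)).
Proof. by rewrite /mean ImZ. Qed.

Lemma eq_mean g1 g2 : g1 =1 g2 -> mean g1 = mean g2.
Proof. by move=> /funext ->. Qed.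

Lemma cintD g1 g2 : cintegrable g1 -> cintegrable g2 -> cintegrable (fun t => g1 t + g2 t).
Proof.
move=> [r1 i1] [r2 i2]; split.
  by under [X in rintegrable X]eq_fun do rewrite ReD; exact: rintD.
by under [X in rintegrable X]eq_fun do rewrite ImD; exact: rintD.
Qed.

Lemma meanD g1 g2 : cintegrable g1 -> cintegrable g2 ->
  mean (fun t => g1 t + g2 t) = mean g1 + mean g2.
Proof.
move=> [r1 i1] [r2 i2]; apply: complexP.
  by rewrite ReD !Re_mean; under eq_avg do rewrite ReD; exact: avgD.
by rewrite ImD !Im_mean; under eq_avg do rewrite ImD; exact: avgD.
Qed.

Lemma cintZ c g : cintegrable g -> cintegrable (fun t => c * g t).
Proof.
move=> [r1 i1]; split.
  under [X in rintegrable X]eq_fun do rewrite ReM; exact: rintB (rintZ _ r1) (rintZ _ i1).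
under [X in rintegrable X]eq_fun do rewrite ImM; exact: rintD (rintZ _ i1) (rintZ _ r1).
Qed.

Lemma meanZ c g : cintegrable g -> mean (fun t => c * g t) = c * mean g.
Proof.
move=> [r1 i1]; apply: complexP.
  rewrite ReM !Re_mean Im_mean; under eq_avg do rewrite ReM.
  by rewrite (avgB (rintZ _ r1) (rintZ _ i1)) !avgZ.
rewrite ImM !Im_mean Re_mean; under eq_avg do rewrite ImM.
by rewrite (avgD (rintZ _ i1) (rintZ _ r1)) !avgZ.
Qed.

Lemma cintB g1 g2 : cintegrable g1 -> cintegrable g2 -> cintegrable (fun t => g1 t - g2 t).
Proof.
move=> c1 c2; under [X in cintegrable X]eq_fun do rewrite -mulN1r.
by apply: cintD => //; exact: cintZ.
Qed.

Lemma meanB g1 g2 : cintegrable g1 -> cintegrable g2 ->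
  mean (fun t => g1 t - g2 t) = mean g1 - mean g2.
Proof.
move=> c1 c2; under eq_mean do rewrite -mulN1r.
by rewrite meanD ?meanZ // ?mulN1r //; exact: cintZ.
Qed.

Lemma mean_ofR h : mean (fun t => ofR (h t)) = ofR (avg h).
Proof. by apply: complexP; rewrite ?Re_mean ?Im_mean //= avg_cst. Qed.

Lemma mean_cst c : mean (fun=> c) = c.
Proof. by apply: complexP; rewrite ?Re_mean ?Im_mean avg_cst. Qed.

Lemma cint_ofR h : rintegrable h -> cintegrable (fun t => ofR (h t)).
Proof. by move=> ih; split => //=; exact: rint_cst. Qed.

Lemma mean_sum (I : Type) (s : seq I) (G : I -> R -> Cplx R) :
  (forall i, cintegrable (G i)) ->
  cintegrable (fun t => \sum_(i <- s) G i t) /\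
  mean (fun t => \sum_(i <- s) G i t) = \sum_(i <- s) mean (G i).
Proof.
move=> cG; elim: s => [|i s [IHc IHm]].
  rewrite big_nil; under [X in cintegrable X]eq_fun do rewrite big_nil.
  under eq_mean do rewrite big_nil; rewrite mean_cst; split => //.
  by split; exact: rint_cst.
rewrite big_cons; under [X in cintegrable X]eq_fun do rewrite big_cons.
under eq_mean do rewrite big_cons; split; first exact: cintD.
by rewrite meanD // IHm.
Qed.

(** The factor 2 comes from bounding the two components separately; every use below tolerates
a constant. *)
Lemma cnorm_mean g h : cintegrable g -> rintegrable h -> (forall t, cnorm (g t) <= h t) ->
  cnorm (mean g) <= 2 * avg h.
Proof.
move=> [ir ii] ih gh; apply: (le_trans (cnorm_ReIm _)).
rewrite mulr_natl mulr2n Re_mean Im_mean lerD //; apply: avg_norm => // t.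
  exact: le_trans (ler_Re _) (gh t).
exact: le_trans (ler_Im _) (gh t).
Qed.

Lemma ccont_cst c : ccont (fun=> c).
Proof. by split => x; exact: cvg_cst. Qed.
Lemma ccont_cis : ccont (@cis R).
Proof. by split => x /=; [exact: continuous_cos|exact: continuous_sin]. Qed.
Lemma ccont_ofR h : continuous h -> ccont (fun t => ofR (h t)).
Proof. by move=> ch; split => // x; exact: cvg_cst. Qed.

Lemma ccontD g1 g2 : ccont g1 -> ccont g2 -> ccont (fun t => g1 t + g2 t).
Proof.
move=> [r1 i1] [r2 i2]; split.
  by under eq_fun do rewrite ReD; move=> x; apply: cvgD; [exact: r1|exact: r2].
by under eq_fun do rewrite ImD; move=> x; apply: cvgD; [exact: i1|exact: i2].
Qed.

Lemma ccontM g1 g2 : ccont g1 -> ccont g2 -> ccont (fun t => g1 t * g2 t).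
Proof.
move=> [r1 i1] [r2 i2]; split.
  under eq_fun do rewrite ReM; move=> x; apply: cvgB; apply: cvgM;
    [exact: r1|exact: r2|exact: i1|exact: i2].
under eq_fun do rewrite ImM; move=> x; apply: cvgD; apply: cvgM;
    [exact: r1|exact: i2|exact: i1|exact: r2].
Qed.

Lemma ccontN g : ccont g -> ccont (fun t => - g t).
Proof.
move=> cg; under [X in ccont X]eq_fun do rewrite -mulN1r.
by apply: ccontM => //; exact: ccont_cst.
Qed.

Lemma ccontB g1 g2 : ccont g1 -> ccont g2 -> ccont (fun t => g1 t - g2 t).
Proof. by move=> c1 c2; apply: ccontD => //; exact: ccontN. Qed.

Lemma cont_cnorm_sqr g : ccont g -> continuous (fun t => cnorm (g t) ^+ 2).
Proof.
move=> [r1 i1]; under eq_fun do rewrite cnorm_sqr.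
move=> x; apply: cvgD; apply: (@cvgM R); by [exact: r1|exact: i1].
Qed.

Lemma cont_cnorm g : ccont g -> continuous (fun t => cnorm (g t)).
Proof.
move=> cg; have := cont_cnorm_sqr cg => c2 x.
under eq_fun do rewrite cnorm_sqrt -cnorm_sqr.
apply: continuous_comp; [exact: c2|exact: sqrt_continuous].
Qed.

Lemma ccontV g : ccont g -> (forall t, g t != 0) -> ccont (fun t => (g t)^-1).
Proof.
move=> cg g0.
have -> : (fun t => (g t)^-1) = (fun t => (g t)^* * ofR (cnorm (g t) ^+ 2)^-1).
  apply: funext => t; rewrite ofRV ofRX -cnormE normCK invfM mulrC divfK //.
  by rewrite conjC_eq0.
apply: ccontM.
  case: (cg) => r1 i1; split.
    by under eq_fun do rewrite Re_conj.
  by under eq_fun do rewrite Im_conj; move=> x; apply: cvgN; exact: i1.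
apply: ccont_ofR => x; apply: cvgV; last exact: cont_cnorm_sqr.
by rewrite expf_eq0 /= cnorm_eq0 g0.
Qed.

Lemma ccontX g n : ccont g -> ccont (fun t => g t ^+ n).
Proof.
move=> cg; elim: n => [|n IHn]; first exact: ccont_cst.
by under [X in ccont X]eq_fun do rewrite exprS; exact: ccontM.
Qed.

Lemma ccont_horner (p : {poly Cplx R}) g : ccont g -> ccont (fun t => p.[g t]).
Proof.
move=> cg; elim/poly_ind: p => [|p c IHp].
  by under [X in ccont X]eq_fun do rewrite horner0; exact: ccont_cst.
under [X in ccont X]eq_fun do rewrite hornerMXaddC.
by apply: ccontD; [exact: ccontM|exact: ccont_cst].
Qed.

Lemma cint_cont g : ccont g -> cintegrable g.
Proof. by move=> [r1 i1]; split; exact: rint_cont. Qed.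

Lemma cintM g h : ccont g -> rintegrable h -> cintegrable (fun t => g t * ofR (h t)).
Proof.
move=> [r1 i1] ih; split.
  under [X in rintegrable X]eq_fun do rewrite mulrC ReZ mulrC; exact: rintM.
under [X in rintegrable X]eq_fun do rewrite mulrC ImZ mulrC; exact: rintM.
Qed.

Lemma cont_ln_cnorm g : ccont g -> (forall t, g t != 0) ->
  continuous (fun t => ln (cnorm (g t))).
Proof.
move=> cg g0 x; apply: continuous_comp; first exact: cont_cnorm.
by apply: continuous_ln; rewrite cnorm_gt0.
Qed.

End CircleMean.
#[global] Hint Resolve measurable_turn : core.

(** * Herglotz integrals and the Schwarz formula *)

Section Herglotz.
Variable R : realType.
Implicit Types (h : R -> R) (z w : Cplx R).

Definition kernel z (t : R) : Cplx R := (cis t + z) / (cis t - z).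
Definition herglotz h z : Cplx R := mean (fun t => kernel z t * ofR (h t)).

Lemma cis_sub_neq0 z t : cnorm z < 1 -> cis t - z != 0.
Proof.
move=> z1; rewrite -cnorm_gt0; apply: lt_le_trans (cnorm_leB _ _).
by rewrite cnorm_cis subr_gt0.
Qed.

Lemma ccont_kernel z : cnorm z < 1 -> ccont (kernel z).
Proof.
move=> z1; apply: ccontM.
  by apply: ccontD; [exact: ccont_cis|exact: ccont_cst].
apply: ccontV => [|t]; last exact: cis_sub_neq0.
by apply: ccontB; [exact: ccont_cis|exact: ccont_cst].
Qed.

Lemma cint_kernel h z : cnorm z < 1 -> rintegrable h ->
  cintegrable (fun t => kernel z t * ofR (h t)).
Proof. by move=> z1 ih; apply: cintM => //; exact: ccont_kernel. Qed.

Lemma herglotzD h1 h2 z : cnorm z < 1 -> rintegrable h1 -> rintegrable h2 ->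
  herglotz (fun t => h1 t + h2 t) z = herglotz h1 z + herglotz h2 z.
Proof.
move=> z1 i1 i2; rewrite /herglotz -meanD; [|exact: cint_kernel..].
by apply: eq_mean => t; rewrite ofRD mulrDr.
Qed.

Lemma herglotzB h1 h2 z : cnorm z < 1 -> rintegrable h1 -> rintegrable h2 ->
  herglotz (fun t => h1 t - h2 t) z = herglotz h1 z - herglotz h2 z.
Proof.
move=> z1 i1 i2; rewrite /herglotz -meanB; [|exact: cint_kernel..].
by apply: eq_mean => t; rewrite ofRB mulrBr.
Qed.

Lemma herglotz0 h : herglotz h 0 = ofR (avg h).
Proof.
rewrite /herglotz -mean_ofR; apply: eq_mean => t.
by rewrite /kernel addr0 subr0 divff ?cis_neq0 // mul1r.
Qed.

Lemma Re_kernel z t : cnorm z < 1 ->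
  complex.Re (kernel z t) * cnorm (cis t - z) ^+ 2 = 1 - cnorm z ^+ 2.
Proof.
move=> z1; have n0 := cis_sub_neq0 t z1.
have : kernel z t * ofR (cnorm (cis t - z) ^+ 2) = (cis t + z) * (cis t - z)^*.
  by rewrite /kernel ofRX -cnormE normCK mulrA divfK.
move/(congr1 (@complex.Re R)); rewrite mulrC ReZ mulrC => ->.
rewrite rmorphB /= !ReImE !Re_conj !Im_conj cnorm_sqr /=.
rewrite -(cos2Dsin2 t); ring.
Qed.

Lemma Re_kernel_ge0 z t : cnorm z < 1 -> 0 <= complex.Re (kernel z t).
Proof.
move=> z1; have n0 : 0 < cnorm (cis t - z) ^+ 2.
  by rewrite exprn_gt0 // cnorm_gt0 cis_sub_neq0.
rewrite -(pmulr_lge0 _ n0) Re_kernel // subr_ge0 expr_le1 ?cnorm_ge0 //.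
exact: ltW.
Qed.

Lemma cnorm_kernel z t : cnorm z < 1 -> cnorm (kernel z t) <= 2 / (1 - cnorm z).
Proof.
move=> z1; rewrite /kernel cnormM cnormV; apply: ler_pM; rewrite ?invr_ge0 ?cnorm_ge0 //.
  by apply: (le_trans (cnormD _ _)); rewrite cnorm_cis; lra.
rewrite lef_pV2 ?posrE ?subr_gt0 ?cnorm_gt0 ?cis_sub_neq0 //.
by rewrite -[X in X - _](cnorm_cis t) cnorm_leB.
Qed.

(** Over a full turn a periodic primitive takes the same value at both ends. *)
Lemma avg_derive (F f : R -> R) : continuous f ->
  (forall t : R, is_derive t 1 F (f t)) -> F (2 * pi) = F 0 -> avg f = 0.
Proof.
move=> cf dF F0.
have dF' (t : R) : derivable F t 1 by have [] := dF t.
have cF : continuous F by move=> t; apply: differentiable_continuous; apply/derivable1_diffP.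
rewrite /avg /Rintegral (@continuous_FTC2 _ f F).
- by rewrite F0 -EFinB subrr mulr0.
- exact: twopi_gt0.
- exact: continuous_subspaceT.
- split => [t _||]; first exact: dF'.
    by apply: cvg_at_right_filter; exact: cF.
  by apply: cvg_at_left_filter; exact: cF.
- by move=> t _; rewrite derive1E; have [] := dF t.
Qed.

Lemma cos_turns n : cos (n%:R * (2 * pi)) = 1 :> R.
Proof. by rewrite !mulr_natl -[_ *+ n]add0r (periodicn (@cosD2pi R)) cos0. Qed.

Lemma sin_turns n : sin (n%:R * (2 * pi)) = 0 :> R.
Proof. by have := periodicn (@sinD2pi R) n 0; rewrite add0r sin0 !mulr_natl. Qed.

Lemma mean_cisX n : (0 < n)%N -> mean (fun t => cis t ^+ n) = 0 :> Cplx R.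
Proof.
move=> n0; have n0' : n%:R != 0 :> R by rewrite pnatr_eq0 -lt0n.
under eq_mean do rewrite cisX.
apply: complexP; rewrite ?Re_mean ?Im_mean /=.
  apply: (@avg_derive (fun t => n%:R^-1 * sin (n%:R * t))) => [t|t|].
  - apply: continuous_comp; last exact: continuous_cos.
    by apply: mulrl_continuous.
  - by apply: is_derive_eq; rewrite /GRing.scale /= mulr1; field.
  - by rewrite sin_turns !mulr0 sin0 mulr0.
apply: (@avg_derive (fun t => - (n%:R^-1 * cos (n%:R * t)))) => [t|t|].
- apply: continuous_comp; last exact: continuous_sin.
  by apply: mulrl_continuous.
- by apply: is_derive_eq; rewrite /GRing.scale /= mulr1; field.
- by rewrite cos_turns mulr0 cos0.
Qed.

Lemma mean_conj (g : R -> Cplx R) : cintegrable g -> mean (fun t => (g t)^*) = (mean g)^*.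
Proof.
move=> [rg ig]; apply: complexP; rewrite ?Re_conj ?Im_conj ?Re_mean ?Im_mean.
  by apply: eq_avg => t; rewrite Re_conj.
rewrite -mulN1r -avgZ //; apply: eq_avg => t; rewrite Im_conj mulN1r //.
Qed.

Lemma ccont_cisV : ccont (fun t : R => (cis t)^-1).
Proof. by apply: ccontV => [|t]; [exact: ccont_cis|exact: cis_neq0]. Qed.

Lemma mean_cisXX n m :
  mean (fun t => (cis t)^-1 ^+ m * cis t ^+ n) = (n == m)%:R :> Cplx R.
Proof.
have [nm|mn|->] := ltngtP n m.
- have e : (0 < m - n)%N by rewrite subn_gt0.
  rewrite -[RHS]conjC0 -(mean_cisX e) -mean_conj; last first.
    by apply: cint_cont; apply: ccontX; exact: ccont_cis.
  apply: eq_mean => t; rewrite rmorphXn /=.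
  rewrite conj_cis.
  by rewrite -{1}(subnK (ltnW nm)) exprD -mulrA -exprMn mulVf ?cis_neq0 // expr1n mulr1.
- have e : (0 < n - m)%N by rewrite subn_gt0.
  rewrite -[RHS]/0 -(mean_cisX e); apply: eq_mean => t.
  by rewrite -{1}(subnK (ltnW mn)) exprD mulrCA -exprMn mulVf ?cis_neq0 // expr1n mulr1.
- rewrite -[RHS]mean_cst; apply: eq_mean => t.
  by rewrite exprVn mulVf // expf_neq0 // cis_neq0.
Qed.

Definition fcoef h n : Cplx R := mean (fun t => (cis t)^-1 ^+ n * ofR (h t)).

(** The Taylor polynomial at 0 of the Herglotz integral: the kernel
(1 + w) / (1 - w), with w = z / cis t, is expanded as a geometric series. *)
Definition herglotz_poly h N : {poly Cplx R} :=
  (ofR (avg h))%:P + \sum_(i < N) (2 * fcoef h i.+1) *: 'X^(i.+1).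

Lemma cint_fcoef h n : rintegrable h -> cintegrable (fun t => (cis t)^-1 ^+ n * ofR (h t)).
Proof. by move=> ih; apply: cintM => //; apply: ccontX; exact: ccont_cisV. Qed.

(** The remainder of the geometric series is kept exact, which makes the truncation error
uniform on every smaller disc. *)
Lemma kernel_trunc z t N (w := z / cis t) : cnorm z < 1 ->
  kernel z t = 1 + 2 * \sum_(i < N) w ^+ i.+1 + 2 * (w ^+ N.+1 / (1 - w)).
Proof.
move=> z1; have c0 := cis_neq0 t.
have n0 := cis_sub_neq0 t z1.
have w1 : 1 - w != 0.
  by rewrite /w -[1](divff c0) -mulrBl mulf_neq0 // invr_eq0.
have -> : kernel z t = (1 + w) / (1 - w).
  by rewrite /kernel /w; field; apply/andP.
have -> : \sum_(i < N) w ^+ i.+1 = w * (1 - w ^+ N) / (1 - w).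
  have -> : 1 - w ^+ N = (1 - w) * \sum_(i < N) w ^+ i.
    by rewrite -[LHS]opprB subrX1 -mulNr opprB.
  apply: (mulIf w1); rewrite divfK //.
  under eq_bigr do rewrite exprS.
  by rewrite -mulr_sumr; ring.
by rewrite exprS; field.
Qed.

Lemma herglotz_poly_mean h z N : rintegrable h ->
  let G t := (1 + 2 * \sum_(i < N) (z / cis t) ^+ i.+1) * ofR (h t) in
  cintegrable G /\ (herglotz_poly h N).[z] = mean G.
Proof.
move=> ih G.
have cs (i : 'I_N) : cintegrable (fun t => z ^+ i.+1 * ((cis t)^-1 ^+ i.+1 * ofR (h t))).
  by apply: cintZ; exact: cint_fcoef.
have [c1 m1] := mean_sum (index_enum 'I_N) cs.
have -> : G = (fun t => ofR (h t) + 2 *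
      (\sum_(i < N) z ^+ i.+1 * ((cis t)^-1 ^+ i.+1 * ofR (h t)))).
  apply: funext => t; rewrite /G mulrDl mul1r -mulrA; congr (_ + 2 * _).
  by rewrite mulr_suml; apply: eq_bigr => i _; rewrite exprMn mulrA.
split; first by apply: cintD; [exact: cint_ofR|exact: cintZ].
rewrite meanD; [|exact: cint_ofR|exact: cintZ].
rewrite mean_ofR meanZ // m1 /herglotz_poly hornerD hornerC horner_sum mulr_sumr.
congr (_ + _); apply: eq_bigr => i _; rewrite hornerZ hornerXn.
by rewrite meanZ; [rewrite mulrAC mulrA|exact: cint_fcoef].
Qed.

Lemma herglotz_approx h z (rho : R) N : rintegrable h -> cnorm z <= rho -> rho < 1 ->
  cnorm (herglotz h z - (herglotz_poly h N).[z]) <=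
    4 * (avg (fun t => `|h t|) / (1 - rho)) * rho ^+ N.+1.
Proof.
move=> ih zr r1; have z1 : cnorm z < 1 by exact: le_lt_trans r1.
have [cG ->] := herglotz_poly_mean z N ih.
have ck := cint_kernel z1 ih.
rewrite /herglotz -meanB //.
have -> : 4 * (avg (fun t => `|h t|) / (1 - rho)) * rho ^+ N.+1 =
  2 * avg (fun t => (2 * (rho ^+ N.+1 / (1 - rho))) * `|h t|).
  by rewrite avgZ; [ring|exact: rint_norm].
apply: cnorm_mean; [exact: cintB|by apply: rintZ; exact: rint_norm|].
move=> t; rewrite -mulrBl cnormM cnorm_ofR ler_wpM2r //.
rewrite (kernel_trunc t N z1) addrC addKr.
set w := z / cis t.
have nw : cnorm w = cnorm z by rewrite /w cnormM cnormV cnorm_cis invr1 mulr1.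
rewrite !cnormM cnormX cnormV nw -[2 : Cplx R](ofR_nat _ 2) cnorm_ofR ger0_norm //.
rewrite ler_wpM2l // ler_pM ?exprn_ge0 ?invr_ge0 ?cnorm_ge0 //.
  by rewrite lerXn2r ?nnegrE ?cnorm_ge0 // (le_trans (cnorm_ge0 z)).
rewrite lef_pV2 ?posrE ?subr_gt0 //.
  by apply: le_trans (cnorm_leB _ _); rewrite cnorm1 nw lerB.
by apply: lt_le_trans (cnorm_leB _ _); rewrite cnorm1 nw subr_gt0.
Qed.

Lemma geometric_small (C rho e : R) : 0 <= rho < 1 -> 0 < e ->
  exists N0, forall N, (N0 <= N)%N -> C * rho ^+ N < e.
Proof.
move=> /andP[r0 r1] e0.
have : (fun N => C * rho ^+ N) @ \oo --> C * 0.
  apply: cvgMr; apply: cvg_expr; by rewrite ger0_norm.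
rewrite mulr0 => /cvgrPdist_lt /(_ _ e0) [N0 _ H]; exists N0 => N /H.
by rewrite sub0r normrN; apply: le_lt_trans; exact: ler_norm.
Qed.

(** On a disc of radius rho < 1 a Herglotz integral of a merely integrable function is a uniform
limit of polynomials. The interchanges of integrals below rest on this, in place of the
theorem of Fubini. *)
Lemma herglotz_uniform h (rho e : R) : rintegrable h -> 0 <= rho < 1 -> 0 < e ->
  exists N0, forall N, (N0 <= N)%N -> forall z, cnorm z <= rho ->
    cnorm (herglotz h z - (herglotz_poly h N).[z]) < e.
Proof.
move=> ih r01 e0; have [N0 H] :=
  geometric_small (4 * (avg (fun t => `|h t|) / (1 - rho))) r01 e0.
exists N0 => N N0N z zr; have /andP[_ r1] := r01.
by apply: (le_lt_trans (herglotz_approx N ih zr r1)); apply: H; exact: leqW.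
Qed.

Lemma eq_cnorm_small (z w : Cplx R) : (forall e, 0 < e -> cnorm (z - w) < e) -> z = w.
Proof.
move=> H; apply/eqP; rewrite -subr_eq0 -cnorm_eq0; apply/eqP/le_anti.
rewrite cnorm_ge0 andbT; apply/ler_addgt0Pl => e e0; rewrite addr0.
exact/ltW/H.
Qed.

(** The Schwarz formula: g is recovered, up to an imaginary constant, from its real part on
the circle. *)
Definition schwarz (g : Cplx R -> Cplx R) := ccont (fun t => g (cis t)) /\
  forall z, cnorm z < 1 -> herglotz (fun t => complex.Re (g (cis t))) z =
     g z - Complex 0 (complex.Im (g 0)).

Lemma schwarzD g1 g2 : schwarz g1 -> schwarz g2 -> schwarz (fun z => g1 z + g2 z).
Proof.
move=> [c1 s1] [c2 s2]; split; first exact: ccontD.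
move=> z z1; under [X in herglotz X]eq_fun do rewrite ReD.
rewrite herglotzD //; [|exact: rint_cont c1.1|exact: rint_cont c2.1].
rewrite s1 // s2 // ImD.
have -> : Complex 0 (complex.Im (g1 0) + complex.Im (g2 0)) = 
  Complex 0 (complex.Im (g1 0)) + Complex 0 (complex.Im (g2 0)) :> Cplx R.
  by apply: complexP; rewrite ?ReD ?ImD //= addr0.
by ring.
Qed.

(** The real part of c e^(int) is (c e^(int) + conj c e^(-int)) / 2, and orthogonality of the
exponentials selects the frequency m + 1. *)
Lemma fcoef_monomial (c : Cplx R) n m :
  2 * fcoef (fun t => complex.Re (c * cis t ^+ n)) m.+1 = c * (n == m.+1)%:R.
Proof.
have ct k : cintegrable (fun t : R => (cis t)^-1 ^+ k * cis t ^+ n).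
  apply: cint_cont; apply: ccontM; apply: ccontX; [exact: ccont_cisV|exact: ccont_cis].
have ct' : cintegrable (fun t : R => c * ((cis t)^-1 ^+ m.+1 * cis t ^+ n)) by exact: cintZ.
have ct2 : cintegrable (fun t : R => c^* * ((cis t)^-1 ^+ (m.+1 + n) * cis t ^+ 0)).
  apply: cintZ; apply: cint_cont; apply: ccontM; apply: ccontX; [exact: ccont_cisV|exact: ccont_cis].
rewrite /fcoef -meanZ; last first.
  apply: cint_fcoef; apply: rint_cont.
  have : ccont (fun t : R => c * cis t ^+ n).
    by apply: ccontM; [exact: ccont_cst|apply: ccontX; exact: ccont_cis].
  by case.
transitivity (mean (fun t : R => c * ((cis t)^-1 ^+ m.+1 * cis t ^+ n) +
   c^* * ((cis t)^-1 ^+ (m.+1 + n) * cis t ^+ 0))).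
  apply: eq_mean => t.
  have e2 : 2 * ofR (complex.Re (c * cis t ^+ n)) = c * cis t ^+ n + (c * cis t ^+ n)^*.
    apply: complexP; rewrite ?ReD ?ImD ?Re_conj ?Im_conj -[2 : Cplx R](ofR_nat _ 2) ?ReZ ?ImZ /=; ring.
  rewrite mulrCA e2 rmorphM rmorphXn /= conj_cis exprD expr0; ring.
rewrite meanD // !meanZ // ?mean_cisXX; last first.
  apply: cint_cont; apply: ccontM; apply: ccontX; [exact: ccont_cisV|exact: ccont_cis].
by rewrite addSn mulr0 addr0.
Qed.

Lemma schwarz_monomial (c : Cplx R) n : schwarz (fun z => c * z ^+ n).
Proof.
have cc : ccont (fun t : R => c * cis t ^+ n).
  by apply: ccontM; [exact: ccont_cst|apply: ccontX; exact: ccont_cis].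
split=> // z z1; apply: eq_cnorm_small => e e0.
have r01 : 0 <= cnorm z < 1 by rewrite cnorm_ge0.
have [N0 H] := herglotz_uniform (rint_cont cc.1) r01 e0.
have := H (maxn N0 n) (leq_maxl _ _) z (lexx _); congr (cnorm (_ - _) < _).
rewrite /herglotz_poly hornerD hornerC horner_sum.
under eq_bigr do rewrite hornerZ hornerXn fcoef_monomial.
case: n cc H => [|n] cc H.
  rewrite big1 ?addr0 => [|i _]; last by rewrite mulr0 mul0r.
  under eq_avg do rewrite expr0 mulr1.
  rewrite avg_cst !expr0 !mulr1; apply: complexP; rewrite ?ReD ?ImD ?ReN ?ImN /=; ring.
have nm : (n < maxn N0 n.+1)%N by rewrite leq_maxr.
rewrite (bigD1 (Ordinal nm)) //= eqxx mulr1 big1 ?addr0 => [|i].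
  rewrite expr0n /= mulr0.
  have -> : avg (fun t => complex.Re (c * cis t ^+ n.+1)) = 0.
    rewrite -Re_mean meanZ; last by apply: cint_cont; apply: ccontX; exact: ccont_cis.
    by rewrite mean_cisX // mulr0.
  by rewrite add0r; apply/esym; rewrite [Complex _ _](_ : _ = 0) ?subr0.
rewrite -val_eqE /= eqSS eq_sym => /negPf ->; by rewrite mulr0 mul0r.
Qed.

Lemma schwarz_poly (p : {poly Cplx R}) : schwarz (fun z => p.[z]).
Proof.
have -> : (fun z => p.[z]) = (fun z => \sum_(i < size p) p`_i * z ^+ i).
  by apply: funext => z; rewrite horner_coef.
elim: (size p) => [|n IHn].
  have -> : (fun z : Cplx R => \sum_(i < 0) p`_i * z ^+ i) = (fun z => 0 * z ^+ 0).
    by apply: funext => z; rewrite big_ord0 mul0r.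
  exact: schwarz_monomial.
have -> : (fun z : Cplx R => \sum_(i < n.+1) p`_i * z ^+ i) =
    (fun z => \sum_(i < n) p`_i * z ^+ i + p`_n * z ^+ n).
  by apply: funext => z; rewrite big_ord_recr.
by apply: schwarzD => //; exact: schwarz_monomial.
Qed.

End Herglotz.

(** * Herglotz integrals on smaller circles *)

Section Dilation.
Variable R : realType.
Implicit Types (h : R -> R) (z w : Cplx R).

Lemma cont_uniform (f : R -> R) :
  (forall e, 0 < e -> exists2 f' : R -> R, continuous f' & forall t, `|f t - f' t| < e) ->
  continuous f.
Proof.
move=> H x; apply/cvgrPdist_lt => e e0.
have e3 : 0 < e / 3 by rewrite divr_gt0.
have [f' cf' ff'] := H _ e3.
have /cvgrPdist_lt/(_ _ e3) := cf' x; apply: filterS => y fxy.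
have -> : f x - f y = (f x - f' x) + (f' x - f' y) - (f y - f' y) by ring.
have -> : e = e / 3 + e / 3 + e / 3 by field.
apply: (le_lt_trans (ler_normB _ _)); apply: ltrD => //.
by apply: (le_lt_trans (ler_normD _ _)); apply: ltrD.
Qed.

Lemma ccont_uniform (g : R -> Cplx R) :
  (forall e, 0 < e -> exists2 g', ccont g' & forall t, cnorm (g t - g' t) < e) ->
  ccont g.
Proof.
move=> H; split; apply: cont_uniform => e /H [g' [r' i'] gg'].
  exists (fun t => complex.Re (g' t)) => // t.
  by rewrite -ReN -ReD; apply: le_lt_trans (ler_Re _) (gg' t).
exists (fun t => complex.Im (g' t)) => // t.
by rewrite -ImN -ImD; apply: le_lt_trans (ler_Im _) (gg' t).
Qed.

Lemma cnorm_herglotz h z e : cnorm z < 1 -> rintegrable h -> (forall t, `|h t| <= e) ->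
  cnorm (herglotz h z) <= 4 / (1 - cnorm z) * e.
Proof.
move=> z1 ih he; have e0 : 0 <= e by apply: le_trans (he 0).
have -> : 4 / (1 - cnorm z) * e = 2 * avg (fun=> 2 / (1 - cnorm z) * e :> R).
  by rewrite avg_cst; ring.
apply: cnorm_mean; [exact: cint_kernel|exact: rint_cst|move=> t].
by rewrite cnormM cnorm_ofR ler_pM ?cnorm_ge0 // cnorm_kernel.
Qed.

Lemma cnorm_Im0 z : cnorm (Complex 0 (complex.Im z)) <= cnorm z.
Proof. by rewrite cnorm_sqrt /= expr0n add0r sqrtr_sqr ler_Im. Qed.

(** Both sides of the Schwarz formula are continuous for uniform convergence on the closed disc. *)
Lemma schwarz_limit (g : Cplx R -> Cplx R) :
  (forall e : R, 0 < e -> exists p : {poly Cplx R},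
     forall z, cnorm z <= 1 -> cnorm (g z - p.[z]) < e) ->
  schwarz g.
Proof.
move=> H; have cg : ccont (fun t => g (cis t)).
  apply: ccont_uniform => e /H [p gp]; exists (fun t => p.[cis t]).
    by apply: ccont_horner; exact: ccont_cis.
  by move=> t; apply: gp; rewrite cnorm_cis.
split => // z z1; apply: eq_cnorm_small => e e0.
have d0 : 0 < 1 - cnorm z by rewrite subr_gt0.
pose K := 4 / (1 - cnorm z) + 2.
have K0 : 0 < K by rewrite addr_gt0 // divr_gt0.
have e1 : 0 < e / K by rewrite divr_gt0.
have [p gp] := H _ e1; have [cp sp] := schwarz_poly p.
have ig : rintegrable (fun t => complex.Re (g (cis t))) by apply: rint_cont; exact: cg.1.
have ip : rintegrable (fun t => complex.Re p.[cis t]) by apply: rint_cont; exact: cp.1.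
have E1 : cnorm (herglotz (fun t => complex.Re (g (cis t)) - complex.Re p.[cis t]) z)
   <= 4 / (1 - cnorm z) * (e / K).
  apply: cnorm_herglotz => // [|t]; first exact: rintB.
  rewrite -ReN -ReD; apply/ltW/(le_lt_trans (ler_Re _)); apply: gp.
  by rewrite cnorm_cis.
rewrite herglotzB // sp // in E1.
have -> : herglotz (fun t : R => complex.Re (g (cis t))) z -
    (g z - Complex 0 (complex.Im (g 0))) =
  (herglotz (fun t : R => complex.Re (g (cis t))) z - (p.[z] - Complex 0 (complex.Im p.[0])))
  + (Complex 0 (complex.Im (g 0 - p.[0])) - (g z - p.[z])).
  rewrite (_ : Complex 0 (complex.Im (g 0 - p.[0])) =
    Complex 0 (complex.Im (g 0)) - Complex 0 (complex.Im p.[0])); first ring.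
  by apply: complexP; rewrite ?ReD ?ReN ?ImD ?ImN /= ?subrr.
have -> : e = 4 / (1 - cnorm z) * (e / K) + (e / K + e / K).
  have Kn : K != 0 by rewrite gt_eqF.
  have -> : 4 / (1 - cnorm z) = K - 2 by rewrite /K addrK.
  by field.
apply: (le_lt_trans (cnormD _ _)); apply: ler_ltD => //.
apply: (le_lt_trans (cnormB _ _)); apply: ltrD; last exact/gp/ltW.
by apply: (le_lt_trans (cnorm_Im0 _)); apply: gp; rewrite cnorm0.
Qed.

(** The semigroup property of the Poisson kernel, in complex form: the restriction of a
Herglotz integral to a smaller disc is the Herglotz integral of its real part there. *)
Lemma herglotz_repr h (r : R) z : rintegrable h -> 0 <= r < 1 -> cnorm z < 1 ->
  ccont (fun t => herglotz h (ofR r * cis t)) /\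
  herglotz (fun t => complex.Re (herglotz h (ofR r * cis t))) z = herglotz h (ofR r * z).
Proof.
move=> ih r01 z1.
have [cH sH] : schwarz (fun z => herglotz h (ofR r * z)).
  apply: schwarz_limit => e e0; have [N H] := herglotz_uniform ih r01 e0.
  exists (herglotz_poly h N \Po (ofR r *: 'X)) => w w1.
  rewrite horner_comp hornerZ hornerX; apply: H => //.
  have /andP[r0 _] := r01.
  by rewrite cnormM cnorm_ofR ger0_norm // ler_piMr.
split=> //; rewrite sH // mulr0 herglotz0 /=.
by apply: complexP; rewrite ?ReD ?ImD ?ReN ?ImN /= subr0.
Qed.

Lemma schwarz_real0 g z : schwarz g -> complex.Im (g 0) = 0 -> cnorm z < 1 ->
  herglotz (fun t => complex.Re (g (cis t))) z = g z.
Proof.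
move=> [_ sg] g0 z1; rewrite sg // g0.
by apply: complexP; rewrite ?ReD ?ImD ?ReN ?ImN /= subr0.
Qed.

Lemma herglotz_cst (c : R) z : cnorm z < 1 -> herglotz (fun=> c) z = ofR c.
Proof.
move=> z1; have := schwarz_real0 (schwarz_poly (ofR c)%:P) _ z1.
rewrite !hornerC => <- //; congr (herglotz _ z).
by apply: funext => t; rewrite hornerC.
Qed.

(** The Poisson kernel is nonnegative. *)
Lemma ler_Re_herglotz h1 h2 z : cnorm z < 1 -> rintegrable h1 -> rintegrable h2 ->
  (forall t, h1 t <= h2 t) ->
  complex.Re (herglotz h1 z) <= complex.Re (herglotz h2 z).
Proof.
move=> z1 i1 i2 h12; rewrite /herglotz !Re_mean; apply: ler_avg.
- by have [] := cint_kernel z1 i1.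
- by have [] := cint_kernel z1 i2.
move=> t; rewrite mulrC ReZ [X in _ <= complex.Re X]mulrC ReZ ler_wpM2r //.
exact: Re_kernel_ge0.
Qed.

End Dilation.

(** * The logarithm of a linear factor *)

Section Log.
Variable R : realType.
Implicit Types (z w : Cplx R).

(** Derivative of a curve in the complex plane, component by component. *)
Definition cder (g : R -> Cplx R) (t : R) (d : Cplx R) :=
  is_derive t 1 (fun t => complex.Re (g t)) (complex.Re d) /\
  is_derive t 1 (fun t => complex.Im (g t)) (complex.Im d).

Lemma cderD g1 g2 t d1 d2 : cder g1 t d1 -> cder g2 t d2 ->
  cder (fun t => g1 t + g2 t) t (d1 + d2).
Proof.
move=> [r1 i1] [r2 i2]; split.
  under eq_fun do rewrite ReD; rewrite ReD; exact: is_deriveD.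
under eq_fun do rewrite ImD; rewrite ImD; exact: is_deriveD.
Qed.

Lemma cderM g1 g2 t d1 d2 : cder g1 t d1 -> cder g2 t d2 ->
  cder (fun t => g1 t * g2 t) t (d1 * g2 t + g1 t * d2).
Proof.
move=> [r1 i1] [r2 i2]; split.
  under eq_fun do rewrite ReM; apply: is_derive_eq.
  by rewrite !ReImE /GRing.scale /=; ring.
under eq_fun do rewrite ImM; apply: is_derive_eq.
by rewrite !ReImE /GRing.scale /=; ring.
Qed.

Lemma cder_cst c t : cder (fun=> c) t 0.
Proof. by split; exact: is_derive_cst. Qed.

Lemma cder_line w t : cder (fun t => ofR t * w) t w.
Proof.
split.
  under eq_fun do rewrite ReZ; apply: is_derive_eq.
  by rewrite /GRing.scale /=; ring.
under eq_fun do rewrite ImZ; apply: is_derive_eq.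
by rewrite /GRing.scale /=; ring.
Qed.

Lemma cder_cexp g t d : cder g t d -> cder (fun t => cexp (g t)) t (cexp (g t) * d).
Proof.
move=> [r1 i1]; split; rewrite /cexp /=; apply: is_derive_eq;
  by rewrite !ReImE /GRing.scale /=; ring.
Qed.

Lemma cder_horner (p : {poly Cplx R}) g t d : cder g t d ->
  cder (fun t => p.[g t]) t (p^`().[g t] * d).
Proof.
move=> dg; elim/poly_ind: p => [|p c IHp].
  under [X in cder X]eq_fun do rewrite horner0.
  by rewrite deriv0 horner0 mul0r; exact: cder_cst.
under [X in cder X]eq_fun do rewrite hornerMXaddC.
rewrite derivD derivC addr0 derivM derivX mulr1 hornerD hornerM hornerX.
have := cderD (cderM IHp dg) (cder_cst c t).
by congr (cder _ _ _); ring.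
Qed.

(** The mean value inequality, applied to both components; hence the factor 2. *)
Lemma cder_MVT g dg (M : R) : (forall t, cder g t (dg t)) ->
  (forall t, 0 <= t <= 1 -> cnorm (dg t) <= M) -> cnorm (g 1 - g 0) <= 2 * M.
Proof.
move=> Dg dM; apply: (le_trans (cnorm_ReIm _)); rewrite mulr_natl mulr2n.
have MV (f df : R -> R) : (forall t : R, is_derive t 1 f (df t)) ->
    (forall t, 0 <= t <= 1 -> `|df t| <= M) -> `|f 1 - f 0| <= M.
  move=> Df dfM.
  have cf : {within `[0, 1], continuous f}.
    apply: continuous_subspaceT => t; apply: differentiable_continuous.
    by apply/derivable1_diffP; have [] := Df t.
  have [c c01 ->] := MVT_segment ler01 (fun x _ => Df x) cf.
  by rewrite subr0 mulr1; apply: dfM; move: c01; rewrite in_itv.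
apply: lerD.
  rewrite ReD ReN; apply: (MV (fun t => complex.Re (g t)) (fun t => complex.Re (dg t))).
    by move=> t; have [] := Dg t.
  by move=> t t01; apply: le_trans (ler_Re _) (dM _ t01).
rewrite ImD ImN; apply: (MV (fun t => complex.Im (g t)) (fun t => complex.Im (dg t))).
  by move=> t; have [] := Dg t.
by move=> t t01; apply: le_trans (ler_Im _) (dM _ t01).
Qed.

Lemma cexp_near1 z : cnorm z <= 1 -> cnorm (cexp z - 1) <= 2 * (expR 1 * cnorm z).
Proof.
move=> z1; have dz t := cder_cexp (cder_line z t).
have := @cder_MVT _ _ (expR 1 * cnorm z) dz; rewrite mul0r cexp0 ofR1 mul1r; apply.
move=> t /andP[t0 t1]; rewrite cnormM ler_wpM2r ?cnorm_ge0 // cnorm_cexp ler_expR.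
apply: (le_trans (Re_leN _)); rewrite cnormM cnorm_ofR ger0_norm //.
by rewrite mulr_ile1 ?cnorm_ge0.
Qed.

(** Partial sums of the logarithm series of log (1 - w). *)
Definition log_poly N : {poly Cplx R} :=
  - \sum_(i < N) (i.+1%:R^-1 : Cplx R) *: 'X^(i.+1).

Lemma log_poly_deriv N : (1 - 'X) * (log_poly N)^`() = 'X^N - 1.
Proof.
have -> : (log_poly N)^`() = - \sum_(i < N) 'X^i.
  rewrite /log_poly derivN raddf_sum; congr (- _); apply: eq_bigr => i _.
  by rewrite /= derivZ derivXn /= -scalerMnr scalerMnl -mulr_natr mulVf ?scale1r ?pnatr_eq0.
by rewrite subrX1 mulrN -mulNr opprB.
Qed.

Lemma log_poly_bound N w (rho : R) : cnorm w <= rho -> rho < 1 ->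
  cnorm (log_poly N).[w] <= (1 - rho)^-1.
Proof.
move=> wr r1; have r0 : 0 <= rho by exact: le_trans (cnorm_ge0 _) wr.
have d0 : 0 < 1 - rho by rewrite subr_gt0.
rewrite /log_poly hornerN cnormN horner_sum.
have : cnorm (\sum_(i < N) ((i.+1%:R^-1 : Cplx R) *: 'X^(i.+1)).[w]) <= \sum_(i < N) rho ^+ i.
  apply: (big_ind2 (fun (x : Cplx R) (y : R) => cnorm x <= y)) => [|x1 y1 x2 y2 h1 h2|i _].
  - by rewrite cnorm0.
  - by apply: (le_trans (cnormD _ _)); exact: lerD.
  - rewrite hornerZ hornerXn cnormM cnormV cnormX -(ofR_nat _ i.+1) cnorm_ofR ger0_norm //.
    rewrite -[leRHS]mul1r ler_pM ?invr_ge0 ?exprn_ge0 ?cnorm_ge0 //.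
      by rewrite invf_le1 ?ltr0n // ler1n.
    apply: (@le_trans _ _ (rho ^+ i.+1)).
      by rewrite lerXn2r ?nnegrE ?cnorm_ge0.
    by rewrite exprS ler_piMl ?exprn_ge0 // ltW.
move/le_trans; apply; rewrite -[leRHS]mul1r ler_pdivlMr //.
have := subrX1 rho N; rewrite mulrC => E.
have -> : (\sum_(i < N) rho ^+ i) * (1 - rho) = 1 - rho ^+ N by rewrite -[RHS]opprB E; ring.
by rewrite gerBl exprn_ge0.
Qed.

(** Along the ray from 0 to w the function (1 - x) exp (- P x), where P is the partial sum,
has derivative - w x^N exp (- P x), because (1 - x) P' = x^N - 1. It starts at 1 and
therefore stays close to 1. *)
Lemma log_poly_approx N w (rho : R) : cnorm w <= rho -> rho < 1 ->
  cnorm ((1 - w) * cexp (- (log_poly N).[w]) - 1) <= 2 * expR (1 - rho)^-1 * rho ^+ N.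
Proof.
move=> wr r1; have r0 : 0 <= rho by exact: le_trans (cnorm_ge0 _) wr.
pose q : {poly Cplx R} := - log_poly N.
pose g t := (1 - 'X).[ofR t * w] * cexp q.[ofR t * w].
have dg t : cder g t (- (w * (ofR t * w) ^+ N * cexp q.[ofR t * w])).
  have dl := cder_line w t.
  have := cderM (cder_horner (1 - 'X) dl) (cder_cexp (cder_horner q dl)).
  congr (cder _ _ _).
  rewrite /q; move: (log_poly N) (log_poly_deriv N) => L /(congr1 (horner^~ (ofR t * w))) /=.
  rewrite derivN derivB derivX derivC !(hornerD, hornerN, hornerM, hornerC, hornerX, hornerXn).
  set x := ofR t * w; set u := L^`().[x] => E.
  have -> : (1 - x) * (cexp (- L.[x]) * (- u * w)) =
     - (cexp (- L.[x]) * w) * ((1 - x) * u) by ring.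
  by rewrite E; ring.
have := cder_MVT (M := expR (1 - rho)^-1 * rho ^+ N) dg.
rewrite /g mul0r ofR1 mul1r /q ![(- log_poly N).[_]]hornerN
  !(hornerD, hornerC) ![(- 'X).[_]]hornerN !hornerX.
have -> : (log_poly N).[0] = 0.
  rewrite /log_poly hornerN horner_sum big1 ?oppr0 // => i _.
  by rewrite hornerZ hornerXn expr0n mulr0.
rewrite subr0 oppr0 cexp0 mulr1 mulrA; apply.
move=> t /andP[t0 t1]; rewrite cnormN !cnormM cnorm_cexp cnormX.
have tw : cnorm (ofR t * w) <= rho.
  rewrite cnormM cnorm_ofR ger0_norm // (le_trans _ wr) // ler_piMl ?cnorm_ge0 //.
rewrite mulrC ler_pM ?mulr_ge0 ?exprn_ge0 ?cnorm_ge0 ?expR_ge0 //.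
  rewrite ler_expR; apply: (le_trans (Re_leN _)); rewrite hornerN cnormN.
  exact: log_poly_bound.
rewrite -[leRHS]mul1r ler_pM ?exprn_ge0 ?cnorm_ge0 //.
  by apply: le_trans wr (ltW r1).
by rewrite lerXn2r ?nnegrE ?cnorm_ge0.
Qed.

Lemma ln_near1 (y d : R) : `|y - 1| <= d -> d <= 1 / 2 -> `|ln y| <= 2 * d.
Proof.
rewrite ler_norml => /andP[y1 y2] d2; have y0 : 0 < y by lra.
have l1 : ln y <= y - 1 by have := @le_ln1Dx R (y - 1); rewrite [1 + _]addrC subrK; apply; lra.
have l2 : - ln y <= y^-1 - 1.
  have := @le_ln1Dx R (y^-1 - 1); rewrite [1 + _]addrC subrK lnV ?posrE //; apply.
  by rewrite ltrBrDl subrr invr_gt0.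
have yV : y^-1 - 1 <= 2 * d.
  have -> : y^-1 - 1 = (1 - y) / y by field; rewrite gt_eqF.
  rewrite ler_pdivrMr //.
  have : d * 1 <= d * (2 * y) by rewrite ler_wpM2l //; lra.
  lra.
by rewrite ler_norml; apply/andP; split; lra.
Qed.

(** The partial sums P of log (1 - b w) satisfy the Schwarz formula, and their real parts
converge uniformly to ln |1 - b w| on the circle; hence P z converges to the Herglotz
integral, while exp (P z) converges to 1 - b z. *)
Lemma outer_linear (b z : Cplx R) : cnorm b < 1 -> cnorm z < 1 ->
  cexp (herglotz (fun t => ln (cnorm (1 - b * cis t))) z) = 1 - b * z.
Proof.
move=> b1 z1.
have nz w : cnorm w <= 1 -> 1 - b * w != 0.
  move=> w1; rewrite -cnorm_gt0; apply: lt_le_trans (cnorm_leB _ _).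
  rewrite cnorm1 cnormM subr_gt0; apply: le_lt_trans b1.
  by rewrite ler_piMr ?cnorm_ge0.
have cl : ccont (fun t => 1 - b * cis t).
  apply: ccontB; first exact: ccont_cst.
  by apply: ccontM; [exact: ccont_cst|exact: ccont_cis].
have il : rintegrable (fun t => ln (cnorm (1 - b * cis t))).
  by apply/rint_cont/cont_ln_cnorm => // t; apply: nz; rewrite cnorm_cis.
set H := herglotz _ z; set rho := cnorm b in b1.
have r01 : 0 <= rho < 1 by rewrite cnorm_ge0.
have d0 : 0 < 1 - cnorm z by rewrite subr_gt0.
pose K := 4 / (1 - cnorm z) * 2.
have K0 : 0 < K by rewrite mulr_gt0 // divr_gt0.
(* exp (- H) is multiplied out, so that only exp near 0 has to be estimated. *)
apply: (mulIf (cexp_neq0 (- H))); rewrite -cexpD subrr cexp0.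
apply: eq_cnorm_small => e e0.
(* The bounds on d serve in turn: the estimate of ln near 1, |P z - H| <= 1, and the two
   halves of the final triangle inequality. *)
pose d := Num.min (1 / 2) (Num.min (1 / K) (Num.min (e / (4 * expR 1)) (e / (8 * (expR 1 * K))))).
have eK : 0 < expR 1 * K by rewrite mulr_gt0 // expR_gt0.
have dpos : 0 < d.
  rewrite /d !lt_min; apply/and4P.
  by split; rewrite divr_gt0 // mulr_gt0 // expR_gt0.
have [N0 HN] := geometric_small (2 * expR (1 - rho)^-1) r01 dpos.
have {HN} HN := HN N0 (leqnn _); set N := N0 in HN.
pose P := log_poly N \Po (b *: 'X).
have PE w : P.[w] = (log_poly N).[b * w] by rewrite /P horner_comp hornerZ hornerX.
have app w : cnorm w <= 1 -> cnorm ((1 - b * w) * cexp (- P.[w]) - 1) < d.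
  move=> w1; apply: le_lt_trans HN; rewrite PE; apply: log_poly_approx => //.
  by rewrite cnormM ler_piMr ?cnorm_ge0.
have [d1 d2 d3 d4] : [/\ d <= 1 / 2, d <= 1 / K, d <= e / (4 * expR 1) &
    d <= e / (8 * (expR 1 * K))].
  by move: (lexx d); rewrite {2}/d !le_min => /and4P[].
have P0 : complex.Im P.[0] = 0.
  rewrite PE mulr0 /log_poly hornerN horner_sum big1 ?oppr0 // => i _.
  by rewrite hornerZ hornerXn expr0n mulr0.
have sP := schwarz_poly P; have hP := schwarz_real0 sP P0 z1.
have HP : cnorm (H - P.[z]) <= K * d.
  rewrite -hP /H -herglotzB //; last exact: rint_cont sP.1.1.
  rewrite /K -mulrA; apply: cnorm_herglotz => //.
    by apply: rintB => //; exact: rint_cont sP.1.1.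
  move=> t; have nt : cnorm (cis t : Cplx R) <= 1 by rewrite cnorm_cis.
  have -> : ln (cnorm (1 - b * cis t)) - complex.Re P.[cis t] =
      ln (cnorm ((1 - b * cis t) * cexp (- P.[cis t]))).
    rewrite cnormM cnorm_cexp ReN lnM ?posrE ?expR_gt0 ?cnorm_gt0 ?nz //.
    by rewrite expRK.
  apply: ln_near1 => //; apply/ltW/(le_lt_trans _ (app _ nt)).
  rewrite ler_norml; apply/andP; split.
    by rewrite lerNl opprB -[X in X - _]cnorm1 (le_trans (cnorm_leB _ _)) // cnorm_distC.
  by rewrite -[X in _ - X]cnorm1 cnorm_leB.
pose x := P.[z] - H.
have x1 : cnorm x <= K * d by rewrite /x cnorm_distC.
have x2 : cnorm x <= 1.
  by apply: (le_trans x1); move: d2; rewrite mul1r -[K^-1]mul1r ler_pdivlMr // mulrC.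
have ex := cexp_near1 x2.
have -> : (1 - b * z) * cexp (- H) = ((1 - b * z) * cexp (- P.[z])) * cexp x.
  by rewrite -mulrA -cexpD /x; congr (_ * cexp _); ring.
have := app z (ltW z1); set q := _ * cexp (- P.[z]) => qd.
rewrite cnorm_distC.
have -> : q * cexp x - 1 = (q - 1) * cexp x + (cexp x - 1) by ring.
apply: (le_lt_trans (cnormD _ _)); rewrite cnormM.
have cx : cnorm (cexp x) <= expR 1.
  by rewrite cnorm_cexp ler_expR; exact: le_trans (Re_leN _) x2.
have E0 : expR 1 != 0 :> R by rewrite gt_eqF ?expR_gt0.
have Kn0 : K != 0 by rewrite gt_eqF.
have t1 : cnorm (q - 1) * cnorm (cexp x) <= e / 4.
  have -> : e / 4 = e / (4 * expR 1) * expR 1 by field.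
  by rewrite ler_pM ?cnorm_ge0 // (le_trans (ltW qd)).
have t2 : cnorm (cexp x - 1) <= e / 4.
  apply: (le_trans ex).
  have -> : e / 4 = 2 * (expR 1 * (K * (e / (8 * (expR 1 * K))))) by field; apply/andP.
  rewrite ler_wpM2l // ler_wpM2l ?expR_ge0 //; apply: (le_trans x1).
  by rewrite ler_wpM2l // ltW.
lra.
Qed.

End Log.

(** * Polynomials without zeros in the closed disc are outer *)

Section Outer.
Variable R : realType.
Implicit Types (h : R -> R) (z w : Cplx R).

(** The zero-free case of an outer function: the log-modulus on the circle is then continuous. *)
Definition outer_rep (g : Cplx R -> Cplx R) :=
  [/\ ccont (fun t => g (cis t)), forall t : R, g (cis t) != 0 &
   exists2 c, cnorm c = 1 & forall z, cnorm z < 1 ->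
     g z = c * cexp (herglotz (fun t => ln (cnorm (g (cis t)))) z)].

Lemma eq_outer_rep g1 g2 : g1 =1 g2 -> outer_rep g1 -> outer_rep g2.
Proof. by move=> /funext ->. Qed.

Lemma outer_repM g1 g2 : outer_rep g1 -> outer_rep g2 -> outer_rep (fun z => g1 z * g2 z).
Proof.
move=> [c1 n1 [a1 a11 e1]] [c2 n2 [a2 a21 e2]]; split; first exact: ccontM.
  by move=> t; rewrite mulf_neq0.
exists (a1 * a2); first by rewrite cnormM a11 a21 mulr1.
move=> z z1; rewrite e1 // e2 // mulrACA -cexpD -herglotzD //; last 2 first.
- exact/rint_cont/cont_ln_cnorm.
- exact/rint_cont/cont_ln_cnorm.
have -> : (fun t => ln (cnorm (g1 (cis t) * g2 (cis t)))) =
    (fun t => ln (cnorm (g1 (cis t))) + ln (cnorm (g2 (cis t)))) => //.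
by apply: funext => t; rewrite cnormM lnM // posrE cnorm_gt0.
Qed.

Lemma outer_rep_cst c : c != 0 -> outer_rep (fun=> c).
Proof.
move=> c0; split=> //; first exact: ccont_cst.
have nc0 : 0 < cnorm c by rewrite cnorm_gt0.
exists (c / ofR (cnorm c)).
  by rewrite cnormM cnormV cnorm_ofR ger0_norm ?cnorm_ge0 // divff // gt_eqF.
move=> z z1; rewrite herglotz_cst // cexp_ofR lnK ?posrE // divfK //.
by rewrite ofR_eq0 gt_eqF.
Qed.

Lemma outer_rep_linear (b : Cplx R) : cnorm b < 1 -> outer_rep (fun z => 1 - b * z).
Proof.
move=> b1; split.
- apply: ccontB; first exact: ccont_cst.
  by apply: ccontM; [exact: ccont_cst|exact: ccont_cis].
- move=> t; rewrite -cnorm_gt0; apply: lt_le_trans (cnorm_leB _ _).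
  by rewrite cnorm1 cnormM cnorm_cis mulr1 subr_gt0.
- exists 1 => [|z z1]; first exact: cnorm1.
  by rewrite mul1r outer_linear.
Qed.

(** A root a lies outside the closed disc, and z - a = - a (1 - z / a) with |1 / a| < 1. *)
Lemma outer_rep_poly (G : {poly Cplx R}) :
  (forall z, cnorm z <= 1 -> G.[z] != 0) -> outer_rep (fun z => G.[z]).
Proof.
move=> G0; have [r Gr] := closed_field_poly_normal G.
have l0 : lead_coef G != 0.
  by rewrite lead_coef_eq0; apply: contraNneq (G0 0 _); rewrite ?cnorm0 // => ->; rewrite horner0.
have r1 : all (fun a => 1 < cnorm a) r.
  apply/allP => a ar; rewrite ltNge; apply/negP => /G0 /negP; apply.
  by rewrite Gr hornerZ horner_prod (big_rem a) //= hornerXsubC subrr mul0r mulr0.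
apply: (@eq_outer_rep (fun z => lead_coef G * (\prod_(a <- r) ('X - a%:P)).[z])).
  by move=> z; rewrite [in RHS]Gr hornerZ.
apply: outer_repM; first exact: outer_rep_cst.
elim: r r1 {Gr} => [|a r IHr] /= => [_|/andP[a1 /IHr{}IHr]].
  apply: (@eq_outer_rep (fun=> 1)) => [z|]; first by rewrite big_nil hornerE.
  by apply: outer_rep_cst; exact: oner_neq0.
have a0 : a != 0 by rewrite -cnorm_gt0 (lt_trans _ a1).
apply: (@eq_outer_rep (fun z => - a * (1 - a^-1 * z) * (\prod_(b <- r) ('X - b%:P)).[z])).
  by move=> z; rewrite big_cons hornerM hornerXsubC; congr (_ * _); field.
apply: outer_repM => //.
apply: outer_repM; first by apply: outer_rep_cst; rewrite oppr_eq0.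
by apply: outer_rep_linear; rewrite cnormV invf_lt1 // (lt_trans _ a1).
Qed.

End Outer.

(** * A maximum principle with almost everywhere boundary values *)

Section Smirnov.
Variable R : realType.
Notation mu := (@lebesgue_measure R).
Notation turn := (`[0, 2 * pi]%classic : set R).
Implicit Types (h k : R -> R) (z w : Cplx R).

Lemma ae_sub (P Q : R -> Prop) : (forall t, P t -> Q t) ->
  {ae mu, forall t, P t} -> {ae mu, forall t, Q t}.
Proof. by move=> PQ; apply: negligibleS => t /= nQ /PQ. Qed.

Lemma avg_dct (f_ : nat -> R -> R) (f g : R -> R) :
  (forall n, rintegrable (f_ n)) -> rintegrable f -> rintegrable g ->
  {ae mu, forall t, turn t -> f_ ^~ t @ \oo --> f t} ->
  (forall n t, `|f_ n t| <= g t) -> avg (f_ n) @[n --> \oo] --> avg f.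
Proof.
move=> if_ iff ig fcv fg; apply: cvgMr.
have := @dominated_convergence _ (measurableTypeR R) R mu turn (@measurable_turn R)
  (fun n => EFin \o f_ n) (EFin \o f) (EFin \o g)
  (fun n => measurable_int mu (if_ n)) (measurable_int mu iff).
case=> // [||_ _ H].
- apply: ae_sub fcv => t H tT; apply: cvg_EFin; first exact: nearW.
  exact: H.
- by apply: aeW => t n _ /=; rewrite lee_fin.
- rewrite /Rintegral; apply: fine_cvg; rewrite fineK //.
  exact: integrable_fin_num.
Qed.

Lemma rint_pos h : rintegrable h -> rintegrable (fun t => Num.max (h t) 0).
Proof.
move=> ih; have -> : (fun t => Num.max (h t) 0) = (fun t => 2^-1 * (h t + `|h t|)).
  apply: funext => t; rewrite maxr_absE subr0 addr0 mulrC //.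
by apply: rintZ; apply: rintD => //; exact: rint_norm.
Qed.

(** An integrable function has small integral above a high level: the absolute continuity that
rules out a positive singular part in the boundary values. *)
Lemma avg_tail k : rintegrable k -> forall e, 0 < e ->
  exists2 M : R, 0 <= M & avg (fun t => Num.max (k t - M) 0) <= e.
Proof.
move=> ik e e0.
have iq n : rintegrable (fun t => Num.max (k t - n%:R) 0).
  by apply: rint_pos; apply: rintB => //; exact: rint_cst.
have : avg (fun t => Num.max (k t - n%:R) 0) @[n --> \oo] --> avg (fun=> 0 : R).
  apply: (avg_dct (g := fun t => `|k t|)) => //.
  - exact: rint_cst.
  - exact: rint_norm.
  - apply: aeW => t _; apply: cvg_near_cst.
    exists (Num.truncn `|k t|).+1 => // n /= kn.
    apply: max_r; rewrite subr_le0.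
    apply: (le_trans (ler_norm _)); apply: ltW.
    apply: (lt_le_trans (truncnS_gt _)); by rewrite ler_nat.
  - move=> n t; rewrite ger0_norm ?le_max ?lexx ?orbT // ge_max normr_ge0 andbT.
    by rewrite lerBlDr (le_trans (ler_norm _)) // lerDl.
rewrite avg_cst => /cvgrPdist_lt/(_ _ e0)[n _ /(_ n (leqnn n))].
rewrite sub0r normrN => H; exists n%:R => //.
exact: le_trans (ler_norm _) (ltW H).
Qed.

Lemma herglotz_radial_cvg k z : rintegrable k -> cnorm z < 1 ->
  complex.Re (herglotz k (ofR r * z)) @[r --> (1:R)^'-] --> complex.Re (herglotz k z).
Proof.
move=> ik z1; apply/cvgrPdist_lt => e e0.
have e3 : 0 < e / 3 by rewrite divr_gt0.
have z01 : 0 <= cnorm z < 1 by rewrite cnorm_ge0.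
have [N0 /(_ N0 (leqnn _))] := herglotz_uniform ik z01 e3.
set p := herglotz_poly k N0 => H.
have [cp _] : ccont (fun r => p.[ofR r * z]).
  apply: ccont_horner; apply: ccontM; last exact: ccont_cst.
  by apply: ccont_ofR => x; exact: cvg_id.
have /cvgrPdist_lt/(_ _ e3) : complex.Re p.[ofR r * z] @[r --> (1:R)^'-] --> complex.Re p.[z].
  by have := cvg_at_left_filter (cp 1); rewrite ofR1 mul1r.
move=> H2; near=> r.
have rz : cnorm (ofR r * z) <= cnorm z.
  rewrite cnormM cnorm_ofR ger0_norm; last by near: r; apply: nbhs_left_ge; exact: ltr01.
  by rewrite ler_piMl ?cnorm_ge0 //; near: r; exact: nbhs_left_le.
have -> : complex.Re (herglotz k z) - complex.Re (herglotz k (ofR r * z)) =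
   complex.Re (herglotz k z - p.[z]) + (complex.Re p.[z] - complex.Re p.[ofR r * z])
   - complex.Re (herglotz k (ofR r * z) - p.[ofR r * z]).
  rewrite !ReD !ReN; ring.
have -> : e = e / 3 + e / 3 + e / 3 by field.
apply: (le_lt_trans (ler_normB _ _)); apply: ltrD; last first.
  exact: le_lt_trans (ler_Re _) (H _ rz).
apply: (le_lt_trans (ler_normD _ _)); apply: ltrD.
  exact: le_lt_trans (ler_Re _) (H _ (lexx _)).
by near: r.
Unshelve. all: by end_near. Qed.

Definition radii (n : nat) : R := 1 - n.+2%:R^-1.

Lemma radii01 n : 0 <= radii n < 1.
Proof.
rewrite /radii subr_ge0 invf_le1 ?ltr0n // ler1n /= gtrBl invr_gt0 ltr0n //.
Qed.

Lemma radii_near (P : R -> Prop) : (\forall r \near (1:R)^'-, P r) ->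
  \forall n \near \oo, P (radii n).
Proof.
have c1 : radii @ \oo --> (1 : R).
  rewrite -[X in _ --> X]subr0; apply: cvgB; first exact: cvg_cst.
  by have := @cvg_harmonic R; rewrite -(cvg_shiftS).
move=> [e /= e0 He]; have /cvgrPdist_lt/(_ _ e0) := c1; apply: filterS => n H.
by apply: He => //; have /andP[] := radii01 n.
Qed.

(** Only the positive part matters for an upper bound, and the kernel is bounded for fixed z. *)
Lemma Re_herglotz_le_pos h z : cnorm z < 1 -> rintegrable h ->
  complex.Re (herglotz h z) <= 2 / (1 - cnorm z) * avg (fun t => Num.max (h t) 0).
Proof.
move=> z1 ih; rewrite /herglotz Re_mean -avgZ; last exact: rint_pos.
apply: ler_avg.
- by have [] := cint_kernel z1 ih.
- by apply: rintZ; exact: rint_pos.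
move=> t; rewrite mulrC ReZ mulrC.
apply: (@le_trans _ _ (complex.Re (kernel z t) * Num.max (h t) 0)).
  by rewrite ler_wpM2l ?Re_kernel_ge0 // le_max lexx.
rewrite ler_wpM2r ?le_max ?lexx ?orbT //.
exact: le_trans (Re_leN _) (cnorm_kernel _ z1).
Qed.

(** A harmonic function whose radial limits are almost everywhere nonpositive need not be
nonpositive (the Poisson kernel itself); it is when it is the Poisson integral of an integrable k.
On the circle of radius r its positive part is at most its truncation at M plus the Poisson
integral of (k - M)^+. The first has mean tending to 0 by bounded convergence, the mean of the
second is that of (k - M)^+, which is small for large M. Integrating against the Poisson kernel
at z and letting r tend to 1 gives the claim. *)
Lemma smirnov_max_principle k : rintegrable k ->
  {ae mu, forall t, turn t -> forall e : R, 0 < e ->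
     \forall r \near (1:R)^'-, complex.Re (herglotz k (ofR r * cis t)) <= e} ->
  forall z, cnorm z < 1 -> complex.Re (herglotz k z) <= 0.
Proof.
move=> ik kae z z1; apply/ler_addgt0Pl => e e0; rewrite addr0.
pose C := 2 / (1 - cnorm z).
have C0 : 0 < C by rewrite divr_gt0 // subr_gt0.
pose d := e / (C * 3); have d0 : 0 < d by rewrite divr_gt0 // mulr_gt0.
have [M M0 qM] := avg_tail ik d0.
set q := (fun t => Num.max (k t - M) 0) in qM.
have iq : rintegrable q by apply: rint_pos; apply: rintB => //; exact: rint_cst.
pose S n t := complex.Re (herglotz k (ofR (radii n) * cis t)).
have cS n : continuous (S n).
  by have [[+ _] _] := @herglotz_repr _ k (radii n) 0 ik (radii01 n) (ltac:(by rewrite cnorm0)).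
have iS n : rintegrable (S n) by exact: rint_cont.
pose T n t := complex.Re (herglotz q (ofR (radii n) * cis t)).
have rz n t : cnorm (ofR (radii n) * cis t) < 1.
  have /andP[r0 r1] := radii01 n.
  by rewrite cnormM cnorm_cis mulr1 cnorm_ofR ger0_norm.
have cT n : ccont (fun t => herglotz q (ofR (radii n) * cis t)) /\ avg (T n) = avg q.
  have := @herglotz_repr _ q (radii n) 0 iq (radii01 n) (ltac:(by rewrite cnorm0)).
  by rewrite mulr0 !herglotz0 => -[? /ofR_inj].
have iT n : rintegrable (T n) by apply: rint_cont; have [[]] := cT n.
have q0 t : 0 <= q t by rewrite /q le_max lexx orbT.
have T0 n t : 0 <= T n t.
  have := ler_Re_herglotz (rz n t) (rint_cst 0) iq q0.
  by rewrite herglotz_cst.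
have ST n t : S n t <= M + T n t.
  have : forall t, k t <= M + q t by move=> u; rewrite /q -lerBlDl le_max lexx.
  move/(ler_Re_herglotz (rz n t) ik (rintD (rint_cst M) iq)).
  rewrite herglotzD //; last exact: rint_cst.
  by rewrite herglotz_cst // ReD.
pose U n t := Num.min (Num.max (S n t) 0) M.
have UE n t : U n t = Num.max (S n t) 0 - Num.max (Num.max (S n t) 0 - M) 0.
  rewrite /U; set s := Num.max (S n t) 0; case: (leP s M) => sM.
    by rewrite max_r ?subr0 // subr_le0.
  by rewrite max_l ?subr_ge0 1?ltW // opprB addrC subrK.
have iP n : rintegrable (fun t => Num.max (S n t) 0) by exact: rint_pos.
have iU n : rintegrable (U n).
  have -> : U n = (fun t => Num.max (S n t) 0 - Num.max (Num.max (S n t) 0 - M) 0).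
    by apply: funext.
  by apply: rintB => //; apply: rint_pos; apply: rintB => //; exact: rint_cst.
have SU n : avg (fun t => Num.max (S n t) 0) <= avg (U n) + d.
  apply: (le_trans _ (lerD (lexx _) qM)); rewrite -(proj2 (cT n)) -avgD //.
  apply: ler_avg => // [|t]; first exact: rintD.
  rewrite UE; set s := Num.max (S n t) 0.
  have sT : s <= M + T n t by rewrite ge_max ST addr_ge0.
  have : Num.max (s - M) 0 <= T n t by rewrite ge_max T0 lerBlDl sT.
  lra.
have Ucv : avg (U n) @[n --> \oo] --> avg (fun=> 0 : R).
  apply: (avg_dct (g := fun=> M)) => //; [exact: rint_cst|exact: rint_cst| |].
    apply: ae_sub kae => t H tT; apply/cvgrPdist_le => x x0.
    apply: filterS (radii_near (H tT x x0)) => n Sx.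
    rewrite sub0r normrN ger0_norm.
      by rewrite /U ge_min ge_max Sx ltW.
    by rewrite /U le_min M0 le_max lexx orbT.
  move=> n t; rewrite ger0_norm; first by rewrite /U ge_min lexx orbT.
  by rewrite /U le_min M0 le_max lexx orbT.
rewrite avg_cst in Ucv.
have [n [U1 K1]] : exists n, `|0 - avg (U n)| < d /\
   `|complex.Re (herglotz k z) - complex.Re (herglotz k (ofR (radii n) * z))| < e / 3.
  have e3 : 0 < e / 3 by rewrite divr_gt0.
  have /cvgrPdist_lt/(_ _ d0) [n1 _ H1] := Ucv.
  have /cvgrPdist_lt/(_ _ e3)/radii_near [n2 _ H2] := herglotz_radial_cvg ik z1.
  exists (maxn n1 n2); split; [apply: H1|apply: H2] => /=; by rewrite ?leq_maxl ?leq_maxr.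
have K2 : complex.Re (herglotz k (ofR (radii n) * z)) <= C * (d + d).
  have [_ <-] := herglotz_repr ik (radii01 n) z1.
  apply: (le_trans (Re_herglotz_le_pos z1 (iS n))).
  rewrite -/C ler_pM2l //; apply: (le_trans (SU n)); rewrite lerD2r.
  by apply: (le_trans (ler_norm _)); rewrite -normrN -sub0r ltW.
have E : C * (d + d) = e / 3 + e / 3 by rewrite /d; field; rewrite gt_eqF.
move: K1; rewrite ltr_norml => /andP[_ K1]; lra.
Qed.

End Smirnov.

(** * Uniqueness of the outer factor of a rational function *)

Section Comparison.
Variable R : realType.
Notation mu := (@lebesgue_measure R).
Notation turn := (`[0, 2 * pi]%classic : set R).
Implicit Types (h k : R -> R) (z w : Cplx R).

Lemma cont_left_ge0 (f : R -> R) : continuous f ->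
  (forall r, 0 < r < 1 -> 0 <= f r) -> 0 <= f 1.
Proof.
move=> cf f0; apply: (cvgr_to_ge (cvg_at_left_filter (cf 1))).
near=> r; apply: f0; apply/andP; split; near: r.
  by apply: nbhs_left_gt; exact: ltr01.
exact: nbhs_left_lt.
Unshelve. all: by end_near. Qed.

(** Pushing a outwards to a / r does not bring it closer to z, because |z| <= 1 <= |a|. *)
Lemma cnorm_scale_root (r : R) z a : 0 < r < 1 -> cnorm z <= 1 -> 1 <= cnorm a ->
  r * cnorm (z - a) <= cnorm (ofR r * z - a).
Proof.
move=> /andP[r0 r1] z1 a1.
rewrite -ler_sqr ?nnegrE ?mulr_ge0 ?cnorm_ge0 ?(ltW r0) // exprMn.
have z2 : cnorm z ^+ 2 <= 1 by rewrite expr_le1 ?cnorm_ge0.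
have a2 : 1 <= cnorm a ^+ 2 by apply: exprn_ege1.
have za : (complex.Re z * complex.Re a + complex.Im z * complex.Im a) <= cnorm a ^+ 2.
  have : 0 <= cnorm (z - a) ^+ 2 by rewrite sqr_ge0.
  move: z2 a2; rewrite !cnorm_sqr !ReD !ImD !ReN !ImN; nra.
move: z2 a2 za; rewrite !cnorm_sqr !ReD !ImD !ReN !ImN !ReZ !ImZ.
move: (complex.Re z) (complex.Im z) (complex.Re a) (complex.Im a) => x y u v z2 a2 za.
have -> : (r * x + - u) ^+ 2 + (r * y + - v) ^+ 2 =
  r ^+ 2 * ((x + - u) ^+ 2 + (y + - v) ^+ 2) +
  (1 - r) * ((1 + r) * (u ^+ 2 + v ^+ 2) - 2 * r * (x * u + y * v)) by ring.
rewrite lerDl mulr_ge0 ?subr_ge0 ?(ltW r1) //.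
suff : 2 * r * (x * u + y * v) <= (1 + r) * (u ^+ 2 + v ^+ 2) by [].
apply: (@le_trans _ _ (2 * r * (u ^+ 2 + v ^+ 2))).
  by rewrite ler_wpM2l // mulr_ge0 // ltW.
by rewrite ler_wpM2r //; lra.
Qed.

Lemma horner_roots_neq0 (A : {poly Cplx R}) (r : seq (Cplx R)) :
  A = lead_coef A *: \prod_(a <- r) ('X - a%:P) -> A != 0 ->
  forall z, A.[z] != 0 -> all (fun a => a != z) r.
Proof.
move=> Ar A0 z; apply: contraNT; rewrite -has_predC => /hasP[a ar /=].
rewrite negbK => /eqP <-; apply/eqP.
by rewrite Ar hornerZ horner_prod (big_rem a) //= hornerXsubC subrr mul0r mulr0.
Qed.

(** The power of r compensates the dilation: it makes the dilated polynomial, which is zero free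
on the closed disc, dominate the original one. *)
Lemma cnorm_scale_poly (A : {poly Cplx R}) (r : R) z : 0 < r < 1 ->
  outer_poly A -> cnorm z <= 1 ->
  r ^+ (size A).-1 * cnorm A.[z] <= cnorm A.[ofR r * z].
Proof.
move=> r01 oA z1; have [s As] := closed_field_poly_normal A.
have A0 : A != 0.
  by apply: contraTneq (oA 0 _) => [->|]; rewrite ?horner0 ?eqxx //; apply/discE; rewrite cnorm0.
have s1 : all (fun a => 1 <= cnorm a) s.
  apply/allP => a sa; rewrite leNgt; apply/negP => /discE /oA.
  by move=> /(horner_roots_neq0 As A0) /allP/(_ _ sa); rewrite eqxx.
have sz : (size A).-1 = size s.
  by rewrite As size_scale ?lead_coef_eq0 // size_prod_XsubC.
rewrite sz As !hornerZ !cnormM mulrCA ler_wpM2l ?cnorm_ge0 //.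
elim: s s1 {As sz} => [_|a s IHs /= /andP[a1 /IHs{}IHs]].
  by rewrite expr0 mul1r !big_nil !hornerE.
rewrite !big_cons !hornerM !hornerXsubC !cnormM exprS mulrACA.
have /andP[/ltW r0 _] := r01.
apply: ler_pM => //; rewrite ?mulr_ge0 ?exprn_ge0 ?cnorm_ge0 //.
exact: cnorm_scale_root.
Qed.

(** Outer functions in the sense of Beurling, with the log-modulus h as a parameter. *)
Definition herglotz_form (V : Cplx R -> Cplx R) h := rintegrable h /\
  exists2 c, cnorm c = 1 & forall z, cnorm z < 1 -> V z = c * cexp (herglotz h z).

Lemma herglotz_form_cnorm V h z : herglotz_form V h -> cnorm z < 1 ->
  cnorm (V z) = expR (complex.Re (herglotz h z)).
Proof. by move=> [_ [c c1 H]] z1; rewrite H // cnormM c1 mul1r cnorm_cexp. Qed.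

Lemma outer_rep_form (g : Cplx R -> Cplx R) : outer_rep g ->
  herglotz_form g (fun t => ln (cnorm (g (cis t)))).
Proof. by move=> [cg g0 rep]; split => //; exact/rint_cont/cont_ln_cnorm. Qed.

(** The polynomial A may vanish on the circle, where ln |A| is unbounded. It is replaced by its
dominating dilations G, zero free on the closed disc; the maximum principle applies to
ln |V / G|, and then the dilation parameter tends to 1. *)
Lemma cnorm_le_boundary V h (A : {poly Cplx R}) : herglotz_form V h -> outer_poly A ->
  {ae mu, forall t, turn t -> forall e : R, 0 < e ->
     \forall r \near (1:R)^'-, cnorm (V (ofR r * cis t)) <= cnorm A.[cis t] + e} ->
  forall z, cnorm z < 1 -> cnorm (V z) <= cnorm A.[z].
Proof.
move=> Vh oA Vae z z1.
have ih : rintegrable h by have [] := Vh.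
set d := (size A).-1.
suff H r : 0 < r < 1 -> 0 <= cnorm A.[ofR r * z] - r ^+ d * cnorm (V z).
  have := @cont_left_ge0 (fun r => cnorm A.[ofR r * z] - r ^+ d * cnorm (V z)).
  rewrite expr1n mul1r ofR1 mul1r subr_ge0; apply => // x.
  apply: cvgB.
    apply: cont_cnorm; apply: ccont_horner; apply: ccontM; last exact: ccont_cst.
    by apply: ccont_ofR => y; exact: cvg_id.
  by apply: cvgMl; exact: exprn_continuous.
move=> r01; have /andP[r0 r1] := r01.
have rn0 : r ^+ d != 0 by rewrite expf_neq0 // gt_eqF.
pose G := (ofR (r ^- d)) *: (A \Po (ofR r *: 'X)).
have GE w : cnorm G.[w] = r ^- d * cnorm A.[ofR r * w].
  rewrite /G hornerZ horner_comp hornerZ hornerX cnormM cnorm_ofR ger0_norm //.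
  by rewrite invr_ge0 exprn_ge0 // ltW.
have G0 w : cnorm w <= 1 -> G.[w] != 0.
  move=> w1; rewrite -cnorm_gt0 GE mulr_gt0 ?invr_gt0 ?exprn_gt0 //.
  rewrite cnorm_gt0; apply: oA; apply/discE.
  rewrite cnormM cnorm_ofR gtr0_norm //; apply: le_lt_trans r1.
  by rewrite ler_piMr // ltW.
have AG w : cnorm w <= 1 -> cnorm A.[w] <= cnorm G.[w].
  move=> w1; rewrite GE mulrC ler_pdivlMr ?exprn_gt0 // mulrC.
  exact: cnorm_scale_poly.
have oG := outer_rep_poly G0; have Gh := outer_rep_form oG.
set g := (fun t => ln _) in Gh; have ig : rintegrable g by have [] := Gh.
have ratio w : cnorm w < 1 ->
    complex.Re (herglotz (fun t => h t - g t) w) = ln (cnorm (V w)) - ln (cnorm G.[w]).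
  move=> w1; rewrite herglotzB // ReD ReN.
  by rewrite (herglotz_form_cnorm Vh) // (herglotz_form_cnorm Gh) // !expRK.
have Vp w : cnorm w < 1 -> 0 < cnorm (V w).
  by move=> w1; rewrite (herglotz_form_cnorm Vh) // expR_gt0.
have : complex.Re (herglotz (fun t => h t - g t) z) <= 0.
  apply: smirnov_max_principle => //; first exact: rintB.
  apply: ae_sub Vae => t H tT e e0.
  set m := cnorm G.[cis t].
  have m0 : 0 < m by rewrite cnorm_gt0 G0 // cnorm_cis.
  (* The solution of (1 + e) (m - e1) = m + e1. *)
  pose e1 := e * m / (2 + e).
  have e1p : 0 < e1 by rewrite divr_gt0 ?mulr_gt0 // addr_gt0.
  have cG : continuous (fun r : R => cnorm G.[ofR r * cis t]).
    apply: cont_cnorm; apply: ccont_horner; apply: ccontM; last exact: ccont_cst.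
    by apply: ccont_ofR => y; exact: cvg_id.
  have cG1 : cnorm G.[ofR x * cis t] @[x --> (1 : R)^'-] --> m.
    by have := cvg_at_left_filter (cG 1); rewrite ofR1 mul1r.
  have HG : \forall x \near (1:R)^'-, m - e1 < cnorm G.[ofR x * cis t].
    have /cvgrPdist_lt/(_ _ e1p) := cG1; apply: filterS => x.
    by rewrite ltr_norml => /andP[_]; rewrite ltrBlDr ltrBlDl.
  have HV := H tT e1 e1p.
  near=> x.
  have x1 : cnorm (ofR x * cis t) < 1.
    rewrite cnormM cnorm_cis mulr1 cnorm_ofR ger0_norm; near: x.
      exact: nbhs_left_lt.
    by apply: nbhs_left_ge; exact: ltr01.
  have h1 : m - e1 < cnorm G.[ofR x * cis t] by near: x.
  have h2 : cnorm (V (ofR x * cis t)) <= cnorm A.[cis t] + e1 by near: x.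
  have h3 : cnorm A.[cis t] <= m by apply: AG; rewrite cnorm_cis.
  rewrite ratio // lerBlDr -ler_expR expRD !lnK ?posrE ?Vp //; last first.
    by rewrite cnorm_gt0 G0 // ltW.
  have e1E : (1 + e) * (m - e1) = m + e1.
    by rewrite /e1; field; rewrite gt_eqF // addr_gt0.
  apply: (@le_trans _ _ ((1 + e) * (m - e1))); first by rewrite e1E; lra.
  have me : 0 <= m - e1.
    have e1p' : 0 < 1 + e by lra.
    by rewrite -(pmulr_rge0 _ e1p') e1E addr_ge0 // ltW.
  apply: ler_pM => //; [lra|exact: expR_ge1Dx|exact: ltW].
rewrite ratio // subr_le0 ler_ln ?posrE ?Vp // ?cnorm_gt0 ?G0 ?(ltW z1) //.
by rewrite GE mulrC ler_pdivlMr ?exprn_gt0 // subr_ge0 mulrC.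
Unshelve. all: by end_near. Qed.

(** Reflects a root of modulus less than 1 to the outside of the disc, without changing the
modulus on the circle. *)
Definition flip1 (a : Cplx R) : {poly Cplx R} :=
  if cnorm a < 1 then 1 - a^* *: 'X else 'X - a%:P.
Definition flip (l : Cplx R) (s : seq (Cplx R)) := l *: \prod_(a <- s) flip1 a.
Definition blaschke (s : seq (Cplx R)) z : Cplx R :=
  \prod_(a <- s) (if cnorm a < 1 then (z - a) / (1 - a^* * z) else 1).

(** The analogue of the reflected factor for z |-> r z - a: equal modulus on the circle, and no
zero in the closed disc when 0 < r < 1 and |a| is either less than r or at least 1. *)
Definition flip1_at (r : R) (a : Cplx R) : {poly Cplx R} :=
  if cnorm a < 1 then (ofR r)%:P - a^* *: 'X else ofR r *: 'X - a%:P.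
Definition flip_at l r (s : seq (Cplx R)) := l *: \prod_(a <- s) flip1_at r a.

Lemma one_sub_neq0 w : cnorm w < 1 -> 1 - w != 0.
Proof.
move=> w1; rewrite -cnorm_gt0; apply: lt_le_trans (cnorm_leB _ _).
by rewrite cnorm1 subr_gt0.
Qed.

Lemma cnorm_conj_mul_lt1 a z : cnorm a < 1 -> cnorm z <= 1 -> cnorm (a^* * z) < 1.
Proof.
move=> a1 z1; rewrite cnormM cnorm_conj; apply: le_lt_trans a1.
by rewrite ler_piMr ?cnorm_ge0.
Qed.

Lemma flip1E a z : (flip1 a).[z] = if cnorm a < 1 then 1 - a^* * z else z - a.
Proof. by rewrite /flip1; case: ifP => _; rewrite !hornerE. Qed.
Lemma flip1_atE r a z : (flip1_at r a).[z] =
  if cnorm a < 1 then ofR r - a^* * z else ofR r * z - a.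
Proof. by rewrite /flip1_at; case: ifP => _; rewrite !hornerE. Qed.

Lemma flip1_neq0 a z : cnorm z < 1 -> (flip1 a).[z] != 0.
Proof.
move=> z1; rewrite flip1E; case: ltP => a1.
  by apply: one_sub_neq0; apply: cnorm_conj_mul_lt1 => //; exact: ltW.
rewrite -cnorm_gt0 cnorm_distC; apply: lt_le_trans (cnorm_leB _ _).
by rewrite subr_gt0 (lt_le_trans z1).
Qed.

Lemma flip_outer l s : l != 0 -> outer_poly (flip l s).
Proof.
move=> l0 z /discE z1; rewrite /flip hornerZ horner_prod mulf_neq0 //.
by rewrite prodf_seq_neq0; apply/allP => a _ /=; exact: flip1_neq0.
Qed.

Lemma cnorm_prod (I : Type) (s : seq I) (F : I -> Cplx R) :
  cnorm (\prod_(i <- s) F i) = \prod_(i <- s) cnorm (F i).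
Proof.
elim: s => [|i s IHs]; first by rewrite !big_nil cnorm1.
by rewrite !big_cons cnormM IHs.
Qed.

Lemma blaschke_flip l s z : cnorm z <= 1 ->
  (l *: \prod_(a <- s) ('X - a%:P)).[z] = blaschke s z * (flip l s).[z].
Proof.
move=> z1; rewrite /flip !hornerZ mulrCA !horner_prod /blaschke -big_split.
congr (_ * _); apply: eq_bigr => a _ /=; rewrite flip1E hornerXsubC.
case: ltP => a1; last by rewrite mul1r.
by rewrite divfK // one_sub_neq0 // cnorm_conj_mul_lt1.
Qed.

Lemma conj_norm1 z : cnorm z = 1 -> z * z^* = 1.
Proof. by move=> z1; rewrite -normCK cnormE z1 ofR1 expr1n. Qed.

(** On the circle conj z = 1 / z, so the two numbers differ by conjugation and the unimodular
factor z. *)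
Lemma cnorm_reflect (r : R) a z : cnorm z = 1 -> cnorm (ofR r - a^* * z) = cnorm (ofR r * z - a).
Proof.
move=> z1; rewrite -cnorm_conj rmorphB rmorphM /= conjCK.
have -> : (ofR r)^* = ofR r :> Cplx R by apply: complexP; rewrite ?Re_conj ?Im_conj //= oppr0.
rewrite -[LHS]mulr1 -z1 -cnormM mulrBl -mulrA [z^* * z]mulrC conj_norm1 // mulr1 //.
Qed.

Lemma blaschke_circle s z : cnorm z = 1 -> cnorm (blaschke s z) = 1.
Proof.
move=> z1; rewrite /blaschke cnorm_prod big1 // => a _; case: ltP => a1; last exact: cnorm1.
have := cnorm_reflect 1 a z1; rewrite ofR1 mul1r => E.
rewrite cnormM cnormV E mulfV // cnorm_eq0 subr_eq0; apply: contraTneq a1 => <-.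
by rewrite z1 ltxx.
Qed.

Lemma cnorm_flip_circle l s z : cnorm z = 1 ->
  cnorm (flip l s).[z] = cnorm (l *: \prod_(a <- s) ('X - a%:P)).[z].
Proof. by move=> z1; rewrite blaschke_flip ?z1 // cnormM blaschke_circle // mul1r. Qed.

Lemma cnorm_flip_at_circle l r s z : cnorm z = 1 ->
  cnorm (flip_at l r s).[z] = cnorm (l *: \prod_(a <- s) ('X - a%:P)).[ofR r * z].
Proof.
move=> z1; rewrite /flip_at !hornerZ !horner_prod !cnormM !cnorm_prod.
congr (_ * _); apply: eq_bigr => a _; rewrite flip1_atE hornerXsubC.
by case: ltP => // a1; rewrite cnorm_reflect.
Qed.

Lemma flip_at_neq0 l r s : l != 0 -> 0 < r < 1 ->
  all (fun a => (cnorm a < 1) ==> (cnorm a < r)) s ->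
  forall z, cnorm z <= 1 -> (flip_at l r s).[z] != 0.
Proof.
move=> l0 /andP[r0 r1] /allP sr z z1; rewrite /flip_at hornerZ horner_prod mulf_neq0 //.
rewrite prodf_seq_neq0; apply/allP => a /sr /=; rewrite flip1_atE.
case: ltP => [a1 /= ar|a1 _]; rewrite -cnorm_gt0.
  apply: lt_le_trans (cnorm_leB _ _); rewrite subr_gt0 cnorm_ofR gtr0_norm //.
  by apply: le_lt_trans ar; rewrite cnormM cnorm_conj ler_piMr ?cnorm_ge0.
rewrite cnorm_distC; apply: lt_le_trans (cnorm_leB _ _); rewrite subr_gt0.
apply: lt_le_trans a1; rewrite cnormM cnorm_ofR gtr0_norm //.
by apply: le_lt_trans r1; rewrite ler_piMr // ltW.
Qed.

Lemma near_roots_lt (s : seq (Cplx R)) :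
  \forall r \near (1:R)^'-, all (fun a => (cnorm a < 1) ==> (cnorm a < r)) s.
Proof.
elim: s => [|a s IHs]; first exact: nearW.
have Ha : \forall r \near (1:R)^'-, (cnorm a < 1) ==> (cnorm a < r).
  have [a1|_] := ltP (cnorm a) 1; last exact: nearW.
  by apply: filterS (nbhs_left_gt a1) => r ar.
by apply: filterS2 Ha IHs => r /= -> ->.
Qed.

Lemma cont_flip_at l s z : ccont (fun r => (flip_at l r s).[z]).
Proof.
have -> : (fun r => (flip_at l r s).[z]) = (fun r => l * \prod_(a <- s)
   (if cnorm a < 1 then ofR r - a^* * z else ofR r * z - a)).
  apply: funext => r; rewrite /flip_at hornerZ horner_prod; congr (_ * _).
  by apply: eq_bigr => a _; rewrite flip1_atE.
apply: ccontM; first exact: ccont_cst.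
have cid : ccont (fun r : R => ofR r) by apply: ccont_ofR => y; exact: cvg_id.
elim: s => [|a s IHs].
  by under [X in ccont X]eq_fun do rewrite big_nil; exact: ccont_cst.
under [X in ccont X]eq_fun do rewrite big_cons; apply: ccontM => //.
case: ltP => _; apply: ccontB => //; try exact: ccont_cst.
by apply: ccontM => //; exact: ccont_cst.
Qed.

(** On the circle of radius r the modulus of V dominates that of the polynomial, which on the unit
circle is the modulus of [flip_at l r s]. The latter is zero free on the closed disc when r is
close to 1, so Poisson integration of the logarithms carries the inequality inside; then r
tends to 1. *)
Lemma cnorm_ge_flip V h l (s : seq (Cplx R)) : herglotz_form V h -> l != 0 ->
  (forall z, cnorm z < 1 -> cnorm (l *: \prod_(a <- s) ('X - a%:P)).[z] <= cnorm (V z)) ->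
  forall z, cnorm z < 1 -> cnorm (flip l s).[z] <= cnorm (V z).
Proof.
move=> Vh l0 NV z z1; have ih : rintegrable h by have [] := Vh.
have c1 : cnorm (flip_at l r s).[z] @[r --> (1:R)^'-] --> cnorm (flip l s).[z].
  have cc : continuous (fun r => cnorm (flip_at l r s).[z]).
    by apply: cont_cnorm; exact: cont_flip_at.
  have -> : flip l s = flip_at l 1 s; last exact: cvg_at_left_filter (cc 1).
  rewrite /flip_at /flip; congr (_ *: _); apply: eq_bigr => a _.
  by rewrite /flip1 /flip1_at ofR1 scale1r.
have c2 : expR (complex.Re (herglotz h (ofR r * z))) @[r --> (1:R)^'-] --> cnorm (V z).
  rewrite (herglotz_form_cnorm Vh) //.
  by apply: (cvg_comp _ _ (herglotz_radial_cvg ih z1)); exact: continuous_expR.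
apply: (ler_cvg_to c1 c2); near=> r.
have r01 : 0 < r < 1.
  apply/andP; split; near: r; last exact: nbhs_left_lt.
  by apply: nbhs_left_gt; exact: ltr01.
have /andP[r0 r1] := r01.
have sr : all (fun a => (cnorm a < 1) ==> (cnorm a < r)) s.
  by near: r; exact: near_roots_lt.
have oG := outer_rep_form (outer_rep_poly (flip_at_neq0 l0 r01 sr)).
rewrite (herglotz_form_cnorm oG) // ler_expR.
have r01' : 0 <= r < 1 by rewrite r1 ltW.
have [cc <-] := herglotz_repr ih r01' z1.
apply: ler_Re_herglotz => //; [by have [] := oG|exact: rint_cont cc.1|move=> t].
have rt : cnorm (ofR r * cis t) < 1.
  by rewrite cnormM cnorm_cis mulr1 cnorm_ofR gtr0_norm.
rewrite -ler_expR -(herglotz_form_cnorm Vh) // lnK; last first.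
  by rewrite posrE cnorm_gt0 flip_at_neq0 // cnorm_cis.
by rewrite cnorm_flip_at_circle ?cnorm_cis //; exact: NV.
Unshelve. all: by end_near. Qed.

(** On each circle of radius r < 1 the functions V and A have the same log-modulus, and both are
exponentials of its Herglotz integral up to a unimodular constant. *)
Lemma herglotz_form_unique V h (A : {poly Cplx R}) : herglotz_form V h -> outer_poly A ->
  (forall z, cnorm z < 1 -> cnorm (V z) = cnorm A.[z]) ->
  exists2 g, cnorm g = 1 & forall z, cnorm z < 1 -> V z = g * A.[z].
Proof.
move=> Vh oA VA; have [ih [c c1 Vc]] := Vh.
have n0 : cnorm (0 : Cplx R) < 1 by rewrite cnorm0.
have A00 : A.[0] != 0 by apply: oA; exact/discE.
exists (V 0 / A.[0]).
  by rewrite cnormM cnormV VA // mulfV // cnorm_eq0.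
move=> w w1; pose r := (1 + cnorm w) / 2.
have wr : cnorm w < r by rewrite /r; lra.
have r0 : 0 < r by apply: le_lt_trans wr; exact: cnorm_ge0.
have r1 : r < 1 by rewrite /r; lra.
have r01 : 0 <= r < 1 by rewrite r1 ltW.
have rle z : cnorm z <= 1 -> cnorm (ofR r * z) < 1.
  move=> z1; rewrite cnormM cnorm_ofR gtr0_norm //; apply: le_lt_trans r1.
  by rewrite ler_piMr // ltW.
pose Ar := A \Po (ofR r *: 'X).
have ArE z : Ar.[z] = A.[ofR r * z] by rewrite /Ar horner_comp hornerZ hornerX.
have Ar0 z : cnorm z <= 1 -> Ar.[z] != 0.
  by move=> z1; rewrite ArE; apply: oA; apply/discE; exact: rle.
have [_ [c' c'1 HA]] := outer_rep_form (outer_rep_poly Ar0).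
have key z : cnorm z < 1 -> V (ofR r * z) * c' = c * A.[ofR r * z].
  move=> z1; rewrite Vc; last by apply/rle/ltW.
  rewrite -ArE HA //; have [_ <-] := herglotz_repr ih r01 z1.
  have -> : (fun t => complex.Re (herglotz h (ofR r * cis t))) = (fun t => ln (cnorm Ar.[cis t])).
    apply: funext => t; have ct : cnorm (ofR r * cis t) < 1 by apply: rle; rewrite cnorm_cis.
    by rewrite ArE -VA // (herglotz_form_cnorm Vh) // expRK.
  by rewrite mulrAC mulrA.
have wE : w = ofR r * (w / ofR r).
  by rewrite mulrC divfK // ofR_eq0 gt_eqF.
have wr1 : cnorm (w / ofR r) < 1.
  by rewrite cnormM cnormV cnorm_ofR gtr0_norm // ltr_pdivrMr // mul1r.
have k0 := key 0 n0; rewrite mulr0 in k0.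
have kw := key _ wr1; rewrite -wE in kw.
have c'0 : c' != 0 by rewrite -cnorm_gt0 c'1.
apply: (mulIf c'0); rewrite kw mulrAC [_ * c']mulrAC k0.
by rewrite mulfK.
Qed.

(** The uniqueness of the inner-outer factorization for a rational function N / Q: the outer
factor is the obvious one, in which the roots of N are reflected out of the disc. Write
V = a_out Q. The bound |a_in| <= 1 gives |V| >= |N|, hence |V| >= |flip|; the unimodular
radial limits of a_in give radial limits of |V| equal to |N| = |flip| almost everywhere,
hence |V| <= |flip| by the maximum principle. *)
Theorem inner_outer_unique (a_in a_out : Cplx R -> Cplx R) (l : Cplx R)
    (s : seq (Cplx R)) (Q : {poly Cplx R}) (N := l *: \prod_(a <- s) ('X - a%:P)) :
  l != 0 -> (forall z, cnorm z <= 1 -> Q.[z] != 0) ->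
  inner_fun a_in -> outer_fun a_out ->
  (forall z, cnorm z < 1 -> N.[z] / Q.[z] = a_in z * a_out z) ->
  exists2 g, cnorm g = 1 & forall z, cnorm z < 1 -> a_out z = g * ((flip l s).[z] / Q.[z]).
Proof.
move=> l0 Q0 [_ in1 in_ae] [phi [c [_ phi0 iphi c1 aout]]] fact.
pose V z := a_out z * Q.[z].
have oQ := outer_rep_form (outer_rep_poly Q0).
have Vh : herglotz_form V (fun t => ln (phi t) + ln (cnorm Q.[cis t])).
  case: oQ => iq [c' c'1 QE]; split; first exact: rintD.
  exists (c * c').
    by rewrite cnormM c'1 mulr1; apply: ofR_inj; rewrite -cnormE c1.
  move=> z z1; rewrite /V aout; last exact/discE.
  by rewrite QE // mulrACA -cexpD herglotzD.
have NV z : cnorm z < 1 -> N.[z] = a_in z * V z.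
  by move=> z1; rewrite /V mulrA -fact // divfK // Q0 // ltW.
have low := cnorm_ge_flip Vh l0.
have inle z : cnorm z < 1 -> cnorm (a_in z) <= 1.
  by move=> /discE /in1; rewrite cnormE -ofR1 ler_ofR.
have {}low : forall z, cnorm z < 1 -> cnorm (flip l s).[z] <= cnorm (V z).
  apply: low => z z1; rewrite -/N NV // cnormM ler_piMl ?cnorm_ge0 //.
  exact: inle.
have up : forall z, cnorm z < 1 -> cnorm (V z) <= cnorm (flip l s).[z].
  apply: (cnorm_le_boundary Vh); first exact: flip_outer.
  apply: ae_sub in_ae => t H tT e e0; have [lim lim1 cv] := H tT.
  set m := cnorm (flip l s).[cis t].
  have m0 : 0 <= m by exact: cnorm_ge0.
  have mN : m = cnorm N.[cis t] by rewrite /m cnorm_flip_circle // cnorm_cis.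
  (* The solution of (1 - d) (m + e) = m + d. *)
  pose d := e / (1 + m + e).
  have d0 : 0 < d by rewrite divr_gt0 //; lra.
  have d1 : d < 1 by rewrite ltr_pdivrMr; lra.
  have Hin : \forall r \near (1:R)^'-, 1 - d < cnorm (a_in (ofR r * cis t)).
    have od : 0 < ofR d :> Cplx R by rewrite -ofR0 ltr_ofR.
    have /cvgrPdist_lt/(_ _ od) := cv; apply: filterS => r.
    rewrite cnormE ltr_ofR => Hr.
    have l1 : cnorm lim = 1 by apply: ofR_inj; rewrite -cnormE lim1.
    have := cnorm_leB lim (a_in (ofR r * cis t)); rewrite l1; lra.
  have HN : \forall r \near (1:R)^'-, cnorm N.[ofR r * cis t] < m + d.
    have cN : continuous (fun r : R => cnorm N.[ofR r * cis t]).
      apply: cont_cnorm; apply: ccont_horner; apply: ccontM; last exact: ccont_cst.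
      by apply: ccont_ofR => y; exact: cvg_id.
    have := cvg_at_left_filter (cN 1); rewrite ofR1 mul1r -mN.
    move=> /cvgrPdist_lt/(_ _ d0); apply: filterS => r.
    by rewrite ltr_norml => /andP[+ _]; rewrite ltrNl opprB ltrBlDl.
  near=> r.
  have r1 : cnorm (ofR r * cis t) < 1.
    rewrite cnormM cnorm_cis mulr1 cnorm_ofR ger0_norm; near: r.
      exact: nbhs_left_lt.
    by apply: nbhs_left_ge; exact: ltr01.
  have h1 : 1 - d < cnorm (a_in (ofR r * cis t)) by near: r.
  have h2 : cnorm N.[ofR r * cis t] < m + d by near: r.
  rewrite NV // cnormM in h2.
  have dE : (1 - d) * (m + e) = m + d by rewrite /d; field; rewrite gt_eqF //; lra.
  have d1' : 0 < 1 - d by rewrite subr_gt0.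
  rewrite -(ler_pM2l d1') dE; apply: le_trans (ltW h2).
  by rewrite ler_wpM2r ?cnorm_ge0 // ltW.
have VA z : cnorm z < 1 -> cnorm (V z) = cnorm (flip l s).[z].
  by move=> z1; apply: le_anti; rewrite up // low.
have [g g1 Vg] := herglotz_form_unique Vh (flip_outer s l0) VA.
exists g => // z z1; rewrite mulrA -Vg // /V mulfK // Q0 // ltW //.
Unshelve. all: by end_near. Qed.

End Comparison.

(** * Reflected polynomials *)

Section Reflection.
Variable R : realType.
Notation C := (Cplx R).
Implicit Types (z w : C) (f g N Q D E : {poly C}).

Lemma circle_point_inj : injective (fun k : nat => cis (k.+1%:R^-1 : R)).
Proof.
have int k : (k.+1%:R^-1 : R) \in `[0, pi]%R.
  rewrite in_itv /= invr_ge0 ler0n /=; apply: (@le_trans _ _ 1).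
    by rewrite invf_le1 ?ltr0n // ler1n.
  by apply: le_trans (pi_ge2 R); rewrite ler1n.
move=> j k [/cos_inj - /(_ (int j) (int k)) /invr_inj /eqP + _].
by rewrite eqr_nat eqSS => /eqP.
Qed.

(** The circle is infinite. *)
Lemma eq_poly_circle f g : (forall z, cnorm z = 1 -> f.[z] = g.[z]) -> f = g.
Proof.
move=> fg; apply/eqP; rewrite -subr_eq0; apply/negPn/negP => nz.
pose s := [seq cis (k.+1%:R^-1 : R) | k <- iota 0 (size (f - g))].
have us : uniq s by rewrite map_inj_uniq ?iota_uniq //; exact: circle_point_inj.
have rs : all (root (f - g)) s.
  apply/allP => z /mapP[k _ ->]; rewrite /root hornerD hornerN fg ?subrr //.
  exact: cnorm_cis.
by have := max_poly_roots nz rs us; rewrite size_map size_iota ltnn.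
Qed.

Lemma size_revp n g : (size (revp n g) <= n.+1)%N.
Proof. exact: size_poly. Qed.

Lemma revp_circle n g z : (size g <= n.+1)%N -> cnorm z = 1 ->
  (revp n g).[z] = z ^+ n * (g.[z])^*.
Proof.
move=> gn z1; have z0 : z != 0 by rewrite -cnorm_gt0 z1.
rewrite horner_revp //; congr (_ * (g.[_])^*).
apply: (mulfI (_ : z^* != 0)); first by rewrite conjC_eq0.
by rewrite mulfV ?conjC_eq0 // mulrC conj_norm1.
Qed.

Lemma mul_revp_circle n g z : (size g <= n.+1)%N -> cnorm z = 1 ->
  g.[z] * (revp n g).[z] = z ^+ n * `|g.[z]| ^+ 2.
Proof. by move=> gn z1; rewrite revp_circle // normCK mulrCA. Qed.

Lemma cnorm_revp_circle n g z : (size g <= n.+1)%N -> cnorm z = 1 ->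
  cnorm (revp n g).[z] = cnorm g.[z].
Proof.
by move=> gn z1; rewrite revp_circle // cnormM cnormX z1 expr1n mul1r cnorm_conj.
Qed.

(** The roots of the reflection are 0 and the reflections of the roots of g, all in the closed
disc. *)
Lemma revp_neq0_out n g z : (size g <= n.+1)%N -> outer_poly g -> 1 < cnorm z ->
  (revp n g).[z] != 0.
Proof.
move=> gn og z1; have z0 : z != 0 by rewrite -cnorm_gt0 (lt_trans _ z1).
rewrite horner_revp // mulf_neq0 ?expf_neq0 // conjC_eq0 og //.
by apply/discE; rewrite cnormV cnorm_conj invf_lt1 // (lt_trans _ z1).
Qed.

Lemma coprime_revp n Q g : (forall z, cnorm z <= 1 -> Q.[z] != 0) ->
  (size g <= n.+1)%N -> outer_poly g -> coprimep Q (revp n g).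
Proof.
move=> Q0 gn og; apply: Pdiv.ClosedField.root_coprimep => z rz.
apply: revp_neq0_out => //; rewrite ltNge; apply/negP => /Q0.
by move/eqP: rz => ->; rewrite eqxx.
Qed.

Lemma outer_poly_of_neq0 g : (forall z, cnorm z <= 1 -> g.[z] != 0) -> outer_poly g.
Proof. by move=> g0 z /discE z1; apply/g0/ltW. Qed.

Lemma poly_neq0 g z : g.[z] != 0 -> g != 0.
Proof. by apply: contraNneq => ->; rewrite horner0. Qed.

(** The relation |N| = |Q| on the circle becomes N (rev N) = Q (rev Q), so Q divides rev N by
coprimality; since n is exactly the larger degree, the quotient is a constant, unimodular,
and a square root of it is absorbed in D. *)
Lemma inner_denominator N Q n : coprimep N Q ->
  (forall z, cnorm z <= 1 -> Q.[z] != 0) ->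
  (forall z, cnorm z = 1 -> cnorm N.[z] = cnorm Q.[z]) ->
  n = maxn (size N).-1 (size Q).-1 ->
  exists D, [/\ (size D <= n.+1)%N, forall z, cnorm z <= 1 -> D.[z] != 0 &
    N * D = revp n D * Q].
Proof.
move=> cNQ Q0 NQ nE.
have Q00 : Q != 0 by apply: (@poly_neq0 _ 0); apply: Q0; rewrite cnorm0.
have N10 : N.[1] != 0 by rewrite -cnorm_gt0 NQ ?cnorm1 // cnorm_gt0 Q0 // cnorm1.
have N0 : N != 0 by exact: poly_neq0 N10.
have sN : (size N <= n.+1)%N by rewrite nE -ltnS; case: (size N) => //= k; rewrite !ltnS leq_maxl.
have sQ : (size Q <= n.+1)%N by rewrite nE -ltnS; case: (size Q) => //= k; rewrite !ltnS leq_maxr.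
have E1 : N * revp n N = Q * revp n Q.
  apply: eq_poly_circle => z z1; rewrite !hornerM !mul_revp_circle // !cnormE NQ //.
have : Q %| revp n N.
  have : Q %| N * revp n N by rewrite E1 dvdp_mulr.
  by rewrite Gauss_dvdpr // coprimep_sym.
move=> /Pdiv.Field.dvdpP [c cE].
have E2 : N * c = revp n Q.
  by apply: (mulIf Q00); rewrite -mulrA -cE E1 mulrC.
have c0 : c != 0.
  apply: contraTneq (_ : 0 < cnorm (revp n N).[1]) => [c0|].
    by rewrite cE c0 mul0r horner0 cnorm0 ltxx.
  by rewrite cnorm_revp_circle ?cnorm1 // cnorm_gt0.
have sc : (size c <= 1)%N.
  have h1 : ((size c + size Q).-1 <= n.+1)%N by rewrite -size_mul // -cE size_revp.
  have h2 : ((size c + size N).-1 <= n.+1)%N.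
    by rewrite addnC -size_mul // E2 size_revp.
  have q1 : (0 < size Q)%N by rewrite size_poly_gt0.
  have q2 : (0 < size N)%N by rewrite size_poly_gt0.
  by move: h1 h2 nE q1 q2; clear; move: (size c) (size Q) (size N); lia.
have [a aE] : exists a, c = a%:P by exists c`_0; exact: size1_polyC.
subst c.
have a1 : cnorm a = 1.
  have := cnorm_revp_circle sN (cnorm1 R); rewrite cE hornerM hornerC cnormM NQ ?cnorm1 //.
  by move=> h; apply: (mulIf (_ : cnorm Q.[1] != 0)); rewrite ?mul1r // cnorm_eq0 Q0 ?cnorm1.
(* rev (w Q) / (w Q) = (conj w / w) (rev Q) / Q, and conj w / w = 1 / a. *)
pose w := sqrtC a.
have w2 : w ^+ 2 = a by exact: sqrtCK.
have w1 : cnorm w = 1.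
  by apply/eqP; rewrite -(@eqrXn2 _ 2) ?cnorm_ge0 // expr1n -cnormX w2 a1.
have w0 : w != 0 by rewrite -cnorm_gt0 w1.
exists (w *: Q); split.
- exact: leq_trans (size_scale_leq _ _) sQ.
- by move=> z z1; rewrite hornerZ mulf_neq0 // Q0.
apply: eq_poly_circle => z z1; rewrite !hornerM revp_circle //; last first.
  exact: leq_trans (size_scale_leq _ _) sQ.
rewrite hornerZ rmorphM /= [z ^+ n * _]mulrCA -(revp_circle sQ) // -E2 hornerM hornerC.
by rewrite -w2 expr2 -[LHS]mulr1 -(conj_norm1 w1); ring.
Qed.

(** The reflection taken at a degree k large enough for E satisfies X^k E = X^n (rev E), and
comparing degrees bounds that of E. *)
Lemma self_inversive_size n E : (forall z, cnorm z = 1 -> E.[z] = z ^+ n * (E.[z])^*) ->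
  (size E <= n.+1)%N /\ revp n E = E.
Proof.
move=> H; suff sE : (size E <= n.+1)%N.
  by split => //; apply: eq_poly_circle => z z1; rewrite revp_circle // -H.
have [->|E0] := eqVneq E 0; first by rewrite size_poly0.
set k := size E; have sk : (size E <= k.+1)%N by rewrite /k leqnSn.
have EE : 'X^k * E = 'X^n * revp k E.
  apply: eq_poly_circle => z z1; rewrite !hornerM !hornerXn revp_circle // [in LHS]H //.
  by rewrite mulrCA.
have r0 : revp k E != 0.
  have : 'X^k * E != 0 by rewrite mulf_neq0 // -size_poly_eq0 size_polyXn.
  by rewrite EE; apply: contraNneq => ->; rewrite mulr0.
have := congr1 (fun g : {poly C} => size g) EE.
rewrite !size_mul -?size_poly_eq0 ?size_polyXn ?size_poly_eq0 // !addSn /= -/k.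
move=> e; have := size_revp k E.
by rewrite -(leq_add2l n) -e addnS -addSn leq_add2r.
Qed.

(** The roots of Q lie outside the closed disc and those of rev Q inside, so the relation
s = conj s p on the circle forces Q to divide D. Then E = s D satisfies
E = z^n conj E on the circle. *)
Lemma symmetric_numerator N Q D n : coprimep N Q ->
  (forall z, cnorm z <= 1 -> Q.[z] != 0) ->
  (forall z, cnorm z <= 1 -> D.[z] != 0) -> (size D <= n.+1)%N ->
  (forall z, cnorm z = 1 -> N.[z] / Q.[z] = (N.[z] / Q.[z])^* * ((revp n D).[z] / D.[z])) ->
  exists E, [/\ (size E <= n.+1)%N, revp n E = E & E * Q = N * D].
Proof.
move=> cNQ Q0 D0 sD H; pose k := maxn (size N) (size Q).
have sN : (size N <= k.+1)%N by rewrite leqW // leq_maxl.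
have sQ : (size Q <= k.+1)%N by rewrite leqW // leq_maxr.
have Q00 : Q != 0 by apply: (@poly_neq0 _ 0); apply: Q0; rewrite cnorm0.
have E1 : N * D * revp k Q = Q * (revp k N * revp n D).
  apply: eq_poly_circle => z z1; have z1' : cnorm z <= 1 by rewrite z1.
  have := H z z1; have q0 := Q0 z z1'; have d0 := D0 z z1'.
  have qc : (Q.[z])^* != 0 by rewrite conjC_eq0.
  rewrite !hornerM !(revp_circle sN) // !(revp_circle sQ) // rmorphM fmorphV /=.
  move: (N.[z]) (N.[z])^* (Q.[z]) (Q.[z])^* D.[z] (revp n D).[z] q0 d0 qc => a a' b b' d e b0 d0 b'0 h.
  have -> : a * d * (z ^+ k * b') = (a / b) * (b * d * (z ^+ k * b')) by field.
  by rewrite h; field; rewrite d0.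
have QD : Q %| D.
  have : Q %| N * D * revp k Q by rewrite E1 dvdp_mulr.
  rewrite Gauss_dvdpl; last exact: coprime_revp (outer_poly_of_neq0 Q0).
  by rewrite Gauss_dvdpr // coprimep_sym.
have [c cE] := Pdiv.Field.dvdpP _ _ QD.
have [|sE rE] := @self_inversive_size n (c * N); last first.
  by exists (c * N); split => //; rewrite cE; ring.
move=> z z1; have z1' : cnorm z <= 1 by rewrite z1.
have q0 := Q0 z z1'; have d0 := D0 z z1'.
have cN : (c * N).[z] = N.[z] / Q.[z] * D.[z] by rewrite cE !hornerM; field.
rewrite cN {1}H // rmorphM /= revp_circle // mulrA divfK //; ring.
Qed.

(** The relation on the circle becomes the polynomial identity
A1 D (rev A1) (rev D) = Q (rev Q) (D rev D - E rev E / 4); the roots of Q lie outside the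
closed disc, those of rev A1 and rev D inside, so Q divides A1 D. The quotient A satisfies
X^n A (rev A) = X^K (D rev D - E rev E / 4), and A does not vanish at 0, so rev A has the
full degree K of A; comparing degrees gives K <= n. *)
Lemma outer_numerator (A1 Q D E : {poly C}) n :
  (forall z, cnorm z <= 1 -> Q.[z] != 0) ->
  (forall z, cnorm z <= 1 -> D.[z] != 0) ->
  (size D <= n.+1)%N -> (size E <= n.+1)%N -> outer_poly A1 ->
  (forall z, cnorm z = 1 -> `|A1.[z] / Q.[z]| ^+ 2 = 1 - `|E.[z] / D.[z]| ^+ 2 / 4) ->
  exists A : {poly C}, [/\ (size A <= n.+1)%N, A * Q = A1 * D, outer_poly A &
   forall z, cnorm z = 1 -> `|A.[z]| ^+ 2 = `|D.[z]| ^+ 2 - 4^-1 * `|E.[z]| ^+ 2].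
Proof.
move=> Q0 D0 sD sE oA H; pose k := maxn (size A1) (size Q).
have sA : (size A1 <= k.+1)%N by rewrite leqW // leq_maxl.
have sQ : (size Q <= k.+1)%N by rewrite leqW // leq_maxr.
pose G := D * revp n D - 4^-1 *: (E * revp n E).
have GE z : cnorm z = 1 -> G.[z] = z ^+ n * (`|D.[z]| ^+ 2 - 4^-1 * `|E.[z]| ^+ 2).
  move=> z1; rewrite /G hornerD hornerN hornerZ !hornerM !mul_revp_circle //.
  by ring.
have H' z : cnorm z = 1 -> `|A1.[z]| ^+ 2 * `|D.[z]| ^+ 2 =
    `|Q.[z]| ^+ 2 * (`|D.[z]| ^+ 2 - 4^-1 * `|E.[z]| ^+ 2).
  move=> z1; have z1' : cnorm z <= 1 by rewrite z1.
  have := H z z1; rewrite !normrM !normfV.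
  have : `|Q.[z]| != 0 by rewrite normr_eq0 Q0.
  have : `|D.[z]| != 0 by rewrite normr_eq0 D0.
  move: `|A1.[z]| `|D.[z]| `|Q.[z]| `|E.[z]| => a d q e d0 q0 h.
  have -> : a ^+ 2 * d ^+ 2 = (a / q) ^+ 2 * (q ^+ 2 * d ^+ 2) by field.
  by rewrite h; field.
have E1 : A1 * D * (revp k A1 * revp n D) = Q * (revp k Q * G).
  apply: eq_poly_circle => z z1; rewrite !hornerM mulrACA [Q.[z] * _]mulrA.
  rewrite (mul_revp_circle sA z1) (mul_revp_circle sD z1) (mul_revp_circle sQ z1).
  by rewrite GE // mulrACA H' //; ring.
have QD : Q %| A1 * D.
  have : Q %| A1 * D * (revp k A1 * revp n D) by rewrite E1 dvdp_mulr.
  rewrite Gauss_dvdpl // coprimepMr !coprime_revp //; exact: outer_poly_of_neq0.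
have [A AE] := Pdiv.Field.dvdpP _ _ QD.
have oA' : outer_poly A.
  move=> z dz; have : (A1 * D).[z] != 0.
    by rewrite hornerM mulf_neq0 ?oA // D0 //; apply/ltW/discE.
  by rewrite AE hornerM; apply: contraNneq => ->; rewrite mul0r.
have HA z : cnorm z = 1 -> `|A.[z]| ^+ 2 = `|D.[z]| ^+ 2 - 4^-1 * `|E.[z]| ^+ 2.
  move=> z1; have z1' : cnorm z <= 1 by rewrite z1.
  have q0 : `|Q.[z]| ^+ 2 != 0 by rewrite expf_neq0 // normr_eq0 Q0.
  apply: (mulfI q0); rewrite -H' // -!exprMn -!normrM mulrC -!hornerM.
  by rewrite -AE.
exists A; split => //.
have A00 : A.[0] != 0 by apply: oA'; apply/discE; rewrite cnorm0.
have An0 : A != 0 by exact: poly_neq0 A00.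
set K := (size A).-1.
have sK : size A = K.+1 by rewrite prednK // size_poly_gt0.
have sr : size (revp K A) = K.+1.
  by apply: size_poly_eq; rewrite /= subnn conjC_eq0 -horner_coef0.
have EE : 'X^n * (A * revp K A) = 'X^K * G.
  apply: eq_poly_circle => z z1; rewrite !hornerM !hornerXn -hornerM hornerM.
  rewrite mul_revp_circle ?sK // GE // HA //; ring.
have rn0 : revp K A != 0 by rewrite -size_poly_eq0 sr.
have sG : (size G <= n + n + 1)%N.
  rewrite /G; apply: (leq_trans (size_polyD _ _)); rewrite geq_max size_polyN.
  apply/andP; split; last apply: (leq_trans (size_scale_leq _ _));
    apply: (leq_trans (size_polyMleq _ _)).
    rewrite -subn1 leq_subLR; apply: leq_trans (leq_add sD (size_revp n D)) _; lia.
  rewrite -subn1 leq_subLR; apply: leq_trans (leq_add sE (size_revp n E)) _; lia.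
have G0 : G != 0.
  have : 'X^n * (A * revp K A) != 0.
    by rewrite !mulf_neq0 // -size_poly_eq0 size_polyXn.
  by rewrite EE; apply: contraNneq => ->; rewrite mulr0.
have := congr1 (fun g : {poly C} => size g) EE.
rewrite !size_mul ?mulf_neq0 // -?size_poly_eq0 ?size_polyXn ?size_poly_eq0 //.
rewrite sr sK => e; move: sG e; move: (size G) => g sG e; lia.
Qed.

End Reflection.

(** * From the open disc to the closed disc *)

Section WithinContinuity.
Variables (K : numFieldType) (A : set K).
Implicit Types f g : K -> K.

Lemma horner_continuous (N : {poly K}) : continuous (horner N : K -> K).
Proof.
elim/poly_ind: N => [|N c IHN].
  have -> : horner (0 : {poly K}) = (fun=> 0 : K).
    by apply: funext => z; rewrite horner0.
  by move=> z; exact: cst_continuous.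
have -> : horner (N * 'X + c%:P) = (fun z : K => (N.[z] : K) * z + c : K).
  by apply: funext => z; rewrite hornerMXaddC.
by move=> z; exact: (cvgD (cvgM (IHN z) cvg_id) (cvg_cst _)).
Qed.

Lemma within_horner (N : {poly K}) : {within A, continuous (horner N : K -> K)}.
Proof. exact/continuous_subspaceT/horner_continuous. Qed.

Lemma within_cst (c : K) : {within A, continuous (fun=> c : K)}.
Proof. exact/continuous_subspaceT/cst_continuous. Qed.

Lemma withinM f g : {within A, continuous f} -> {within A, continuous g} ->
  {within A, continuous (fun z => f z * g z)}.
Proof.
move=> /subspace_continuousP cf /subspace_continuousP cg; apply/subspace_continuousP => z dz.
by apply: cvgM; [exact: cf|exact: cg].
Qed.

Lemma withinV f : {within A, continuous f} -> (forall z, A z -> f z != 0) ->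
  {within A, continuous (fun z => (f z)^-1)}.
Proof.
move=> /subspace_continuousP cf f0; apply/subspace_continuousP => z dz.
by apply: cvgV; [exact: f0|exact: cf].
Qed.

End WithinContinuity.

Section ClosedDisc.
Variable R : realType.
Notation C := (Cplx R).
Implicit Types (z w : C) (f g : C -> C) (N Q : {poly C}).

Lemma gt0_ofR (e : C) : 0 < e -> exists2 d : R, 0 < d & e = ofR d.
Proof.
move=> e0; have er : e = ofR (cnorm e) by rewrite -cnormE gtr0_norm.
by exists (cnorm e) => //; rewrite -ltr_ofR -er.
Qed.

Lemma cvg_radius z : cnorm z <= 1 -> ofR r * z @[r --> (1:R)^'-] --> z.
Proof.
move=> z1; apply/cvgrPdist_lt => e /gt0_ofR [d d0 ->].
have := nbhs_left_ltBl (1:R) d0; move=> H; near=> r.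
rewrite cnormE ltr_ofR.
have -> : z - ofR r * z = ofR (1 - r) * z by rewrite ofRB ofR1 mulrBl mul1r.
have r1 : r < 1 by near: r; exact: nbhs_left_lt.
rewrite cnormM cnorm_ofR ger0_norm ?subr_ge0 ?(ltW r1) //.
apply: (@le_lt_trans _ _ (1 - r)); first by rewrite ler_piMr // subr_ge0 ltW.
by near: r.
Unshelve. all: by end_near. Qed.

Lemma near_disc z : cnorm z <= 1 -> \forall r \near (1:R)^'-, cnorm (ofR r * z) < 1.
Proof.
move=> z1; near=> r.
have r1 : r < 1 by near: r; exact: nbhs_left_lt.
have r0 : 0 <= r by near: r; apply: nbhs_left_ge; exact: ltr01.
rewrite cnormM cnorm_ofR ger0_norm //; apply: le_lt_trans r1.
by rewrite ler_piMr.
Unshelve. all: by end_near. Qed.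

Lemma radial_cvg f z : {within @cdisc R, continuous f} -> cnorm z <= 1 ->
  f (ofR r * z) @[r --> (1:R)^'-] --> f z.
Proof.
move=> /subspace_continuousP cf z1.
have H := cf z ((cdiscE z).2 z1).
apply: cvg_comp H => P /= HP.
have := cvg_radius z1 HP => H1.
apply: filterS2 (near_disc z1) H1 => r r1 H1; apply: H1; apply/cdiscE/ltW/r1.
Qed.

Lemma eq_cdisc f g : {within @cdisc R, continuous f} -> {within @cdisc R, continuous g} ->
  (forall z, cnorm z < 1 -> f z = g z) -> forall z, cnorm z <= 1 -> f z = g z.
Proof.
move=> cf cg fg z z1; have fz := radial_cvg cf z1; have gz := radial_cvg cg z1.
apply: (cvg_unique (@norm_hausdorff _ _) fz); apply: cvg_trans gz; apply: near_eq_cvg.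
by apply: filterS (near_disc z1) => r r1; rewrite fg.
Qed.

Lemma within_poly N : {within @cdisc R, continuous (fun z => N.[z])}.
Proof. exact: within_horner. Qed.

Lemma within_rat N Q : (forall z, cnorm z <= 1 -> Q.[z] != 0) ->
  {within @cdisc R, continuous (fun z => N.[z] / Q.[z])}.
Proof.
move=> Q0; apply: withinM; first exact: within_poly.
by apply: withinV => [|z /cdiscE /Q0 //]; exact: within_poly.
Qed.

(** A zero of Q on the circle would be a zero of N = f Q, against coprimality. *)
Lemma ratrep_cdisc f N Q : {within @cdisc R, continuous f} -> ratrep f N Q ->
  (forall z, cnorm z <= 1 -> Q.[z] != 0) /\
  (forall z, cnorm z <= 1 -> f z = N.[z] / Q.[z]).
Proof.
move=> cf [cNQ H].
have NE z : cnorm z <= 1 -> N.[z] = f z * Q.[z].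
  apply: (@eq_cdisc (fun z => N.[z]) (fun z => f z * Q.[z])).
  - exact: within_poly.
  - by apply: withinM; [exact: cf|exact: within_poly].
  - by move=> w /discE/H [q0 ->]; rewrite divfK.
have Q0 z : cnorm z <= 1 -> Q.[z] != 0.
  move=> z1; apply/negP => q0; rewrite coprimep_sym in cNQ.
  by have := coprimep_root cNQ q0; rewrite NE // (eqP q0) mulr0 eqxx.
by split=> // z z1; rewrite NE // mulfK // Q0.
Qed.

Lemma within_blaschke (s : seq C) : {within @cdisc R, continuous (blaschke s)}.
Proof.
elim: s => [|a s IHs].
  rewrite (_ : blaschke [::] = fun=> 1); last by apply: funext => z; rewrite /blaschke big_nil.
  exact: within_cst.
pose f z := if cnorm a < 1 then (z - a) / (1 - a^* * z) else 1.
rewrite (_ : blaschke (a :: s) = fun z => f z * blaschke s z); last first.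
  by apply: funext => z; rewrite /blaschke big_cons.
apply: withinM; last exact: IHs.
have [a1|a1] := ltP (cnorm a) 1; last first.
  rewrite (_ : f = fun=> 1); first exact: within_cst.
  by apply: funext => z; rewrite /f ltNge a1.
rewrite (_ : f = fun z => ('X - a%:P).[z] / (1 - a^* *: 'X).[z]); last first.
  by apply: funext => z; rewrite /f a1 !hornerE.
apply: within_rat => z z1; rewrite !hornerE one_sub_neq0 //.
exact: cnorm_conj_mul_lt1.
Qed.

Lemma l2norm_entry n (v : 'cV[C]_n) i : cnorm (v i 0) <= l2norm v.
Proof.
rewrite /l2norm -[leLHS]ger0_norm ?cnorm_ge0 // -sqrtr_sqr ler_sqrt; last first.
  by apply: sumr_ge0 => j _; exact: sqr_ge0.
by rewrite (bigD1 i) //= lerDl; apply: sumr_ge0 => j _; exact: sqr_ge0.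
Qed.

Lemma l2norm_le n (v : 'cV[C]_n) : l2norm v <= \sum_i cnorm (v i 0).
Proof.
have h0 : 0 <= \sum_i cnorm (v i 0) by apply: sumr_ge0 => i _; exact: cnorm_ge0.
rewrite /l2norm -[leRHS]ger0_norm // -sqrtr_sqr ler_sqrt ?sqr_ge0 //.
rewrite expr2 mulr_suml; apply: ler_sum => i _; rewrite -/(cnorm _) expr2.
rewrite ler_wpM2l ?cnorm_ge0 // (bigD1 i) //= lerDl.
by apply: sumr_ge0 => j _; exact: cnorm_ge0.
Qed.

(** The entry is a coordinate of the image of a basis vector. The supremum is meaningful because
the images of the unit ball are bounded by the sum of the moduli of all entries. *)
Lemma opnorm_entry n (A : 'M[C]_n) i j : cnorm (A i j) <= opnorm A.
Proof.
pose e : 'cV[C]_n := \col_k (k == j)%:R.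
have Ae k : (A *m e) k 0 = A k j.
  rewrite mxE (bigD1 j) //= mxE eqxx mulr1 big1 ?addr0 // => l lj.
  by rewrite mxE (negPf lj) mulr0.
have e1 : l2norm e <= 1.
  apply: (le_trans (l2norm_le _)); rewrite (bigD1 j) //= mxE eqxx cnorm1 big1 ?addr0 //.
  by move=> k kj; rewrite mxE (negPf kj) cnorm0.
apply: (@le_trans _ _ (l2norm (A *m e))); first by rewrite -Ae l2norm_entry.
apply: ub_le_sup; last by exists e.
exists (\sum_i \sum_j cnorm (A i j)) => _ [v v1 <-].
apply: (le_trans (l2norm_le _)); apply: ler_sum => k _; rewrite mxE.
apply: (@le_trans _ _ (\sum_l cnorm (A k l * v l 0))).
  apply: (big_ind2 (fun (x : C) (y : R) => cnorm x <= y)) => // [|x1 y1 x2 y2 h1 h2].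
    by rewrite cnorm0.
  by apply: (le_trans (cnormD _ _)); exact: lerD.
apply: ler_sum => l _; rewrite cnormM ler_piMr ?cnorm_ge0 //.
exact: le_trans (l2norm_entry _ _) v1.
Qed.

Lemma pentablock_s (x : C * C * C) : pentablock x -> cnorm x.1.2 <= 2.
Proof.
move=> [A /= A1 <- /=]; rewrite /mxtrace !big_ord_recl big_ord0 addr0.
apply: (le_trans (cnormD _ _)); rewrite -[2]/(1 + 1) lerD //.
  exact: le_trans (opnorm_entry _ _ _) (ltW A1).
exact: le_trans (opnorm_entry _ _ _) (ltW A1).
Qed.

Lemma closure_pentablock_s a s p : closure (@pentablock R) (a, s, p) -> cnorm s <= 2.
Proof.
move=> cl; rewrite leNgt; apply/negP => s2.
have e0 : 0 < ofR (cnorm s - 2) :> C by rewrite -ofR0 ltr_ofR subr_gt0.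
have cv : (fun x : C * C * C => x.1.2) @ (a, s, p) --> s.
  apply: (cvg_comp fst snd (G := nbhs (a, s))); first exact: cvg_fst.
  exact: cvg_snd.
have /cvgrPdist_lt/(_ _ e0) nb := cv.
have [x [/pentablock_s x2]] := cl _ nb.
rewrite /= cnormE ltr_ofR => sx; have := cnorm_leB s x.1.2; lra.
Qed.

End ClosedDisc.

(** * The polynomials of a penta-inner function *)

Theorem theorem7p5 (R : realType) (a s p : Cplx R -> Cplx R) (m n : nat)
    (a_in a_out : Cplx R -> Cplx R)
    (x_inner : penta_inner a s p)
    (x_degree : penta_degree a s p m n)
    (a_neq0 : exists z, disc z /\ a z != 0)
    (a_in_inner : inner_fun a_in)
    (a_out_outer : outer_fun a_out)
    (a_fact : forall z, disc z -> a z = a_in z * a_out z) :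
  exists A E D : {poly Cplx R},
    [/\ (size A <= n.+1)%N, (size E <= n.+1)%N & (size D <= n.+1)%N] /\
    revp n E = E /\
    (forall z, cdisc z -> D.[z] != 0) /\
    (forall z, cdisc z -> `|E.[z]| <= 2 * `|D.[z]|) /\
    (outer_poly A /\
      forall z, circle z ->
        `|A.[z]| ^+ 2 = `|D.[z]| ^+ 2 - 4^-1 * `|E.[z]| ^+ 2) /\
    (exists2 b_in : Cplx R -> Cplx R, cdisc_extension a_in b_in &
      forall z, cdisc z -> a z = b_in z * (A.[z] / D.[z])) /\
    (forall z, cdisc z -> s z = E.[z] / D.[z]) /\
    (forall z, cdisc z -> p z = (revp n D).[z] / D.[z]).
Proof.
have [[ra rs rp] [ca cs cp] xdisc xcircle] := x_inner.
have [_ [Np [Qp [rNp nE]]]] := x_degree.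
have [Na [Qa rNa]] := ra; have [Ns [Qs rNs]] := rs.
have [Qp0 pE] := ratrep_cdisc cp rNp.
have [Qs0 sE] := ratrep_cdisc cs rNs.
have [Qa0 aE] := ratrep_cdisc ca rNa.
have le1 (z : Cplx R) : cnorm z = 1 -> cnorm z <= 1 by move=> ->.
have bd z : cnorm z = 1 -> [/\ `|p z| = 1, s z = (s z)^* * p z,
    cnorm (s z) <= 2 & `|a z| = sqrtC (1 - `|s z| ^+ 2 / 4)].
  move=> /circleE/xcircle [s2 p1 sp a2]; split => //.
  by rewrite -ler_ofR -cnormE ofR_nat.
have [|D [sD D0 ND]] := inner_denominator rNp.1 Qp0 _ nE.
  move=> z z1; have [p1 _ _ _] := bd z z1; have q0 := Qp0 z (le1 z z1).
  apply: ofR_inj; rewrite -!cnormE; move: p1; rewrite pE ?le1 // normrM normfV.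
  by move/divr1_eq.
have pD z : cnorm z <= 1 -> p z = (revp n D).[z] / D.[z].
  move=> z1; rewrite pE //; apply/eqP; rewrite eqr_div ?Qp0 ?D0 //.
  by rewrite -!hornerM ND.
have [|E [sEn rE EN]] := symmetric_numerator rNs.1 Qs0 D0 sD.
  move=> z z1; have [_ sp _ _] := bd z z1.
  by rewrite -sE ?le1 // -pD ?le1.
have sED z : cnorm z <= 1 -> s z = E.[z] / D.[z].
  move=> z1; rewrite sE //; apply/eqP; rewrite eqr_div ?Qs0 ?D0 //.
  by rewrite -!hornerM EN.
have s2 z : cnorm z <= 1 -> cnorm (s z) <= 2.
  rewrite le_eqVlt => /orP[/eqP/bd[]//|/discE/xdisc].
  exact: closure_pentablock_s.
(* a = B A1 / Qa on the closed disc, with B a finite Blaschke product and A1 outer. *)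
have [r NaE] := closed_field_poly_normal Na; set l := lead_coef Na in NaE.
have l0 : l != 0.
  rewrite lead_coef_eq0; have [z [/discE z1]] := a_neq0.
  by apply: contraNneq => N0; rewrite aE ?(ltW z1) // N0 horner0 mul0r.
pose A1 := flip l r; have oA1 : outer_poly A1 by exact: flip_outer.
have aB z : cnorm z <= 1 -> a z = blaschke r z * (A1.[z] / Qa.[z]).
  by move=> z1; rewrite aE // NaE blaschke_flip // mulrA.
have [|A0 [sA0 AQ oA0 A0E]] := outer_numerator Qa0 D0 sD sEn oA1.
  move=> z z1; have [_ _ _ a2] := bd z z1.
  have -> : `|A1.[z] / Qa.[z]| = `|a z|.
    by rewrite aB ?le1 // [in RHS]normrM [`|blaschke _ _|]cnormE blaschke_circle // mul1r.
  by rewrite a2 sqrtCK sED ?le1.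
have AD z : cnorm z <= 1 -> A1.[z] / Qa.[z] = A0.[z] / D.[z].
  by move=> z1; apply/eqP; rewrite eqr_div ?Qa0 ?D0 // -!hornerM AQ.
have [|g g1 aoutE] := inner_outer_unique l0 Qa0 a_in_inner a_out_outer (s := r).
  by move=> z z1; rewrite -NaE -aE ?(ltW z1) // a_fact //; apply/discE.
have g0 : g != 0 by rewrite -cnorm_gt0 g1.
(* The constant relating a_out to A1 / Qa is moved into A, so that a_in itself is the inner
   factor. *)
exists (g *: A0), E, D; split; [split=> //|split=> //].
  exact: leq_trans (size_scale_leq _ _) sA0.
split; first by move=> z /cdiscE /D0.
split.
  move=> z /cdiscE z1; have := s2 z z1; rewrite sED // cnormM cnormV.
  rewrite ler_pdivrMr ?cnorm_gt0 ?D0 // => h.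
  by rewrite !cnormE -[2 : Cplx R](ofR_nat _ 2) -ofRM ler_ofR.
split.
  split.
    by move=> z dz; rewrite hornerZ mulf_neq0 // oA0.
  by move=> z /circleE z1; rewrite hornerZ normrM [`|g|]cnormE g1 ofR1 mul1r A0E.
split; last by split=> z /cdiscE z1; [exact: sED|exact: pD].
exists (fun z => g^-1 * blaschke r z).
  split.
    apply: withinM; last exact: within_blaschke.
    exact: within_cst.
  move=> z dz; have z1 : cnorm z < 1 by apply/discE.
  have q0 : A1.[z] / Qa.[z] != 0.
    by rewrite mulf_neq0 ?invr_eq0 ?Qa0 ?oA1 ?(ltW z1).
  have := a_fact z dz; rewrite aB ?(ltW z1) // aoutE // => h.
  apply: (mulIf q0); apply: (mulfI g0).
  by rewrite -mulrA mulVKf // h mulrCA.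
move=> z /cdiscE z1; rewrite aB // AD // hornerZ; field.
by rewrite g0 D0.
Qed.
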